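(* Let $n\ge1$ and suppose the scale factor $a$ satisfies Assumption $H_1$ or Assumption $H_2$. Then there exists a constant $\varepsilon_0>0$ such that for every $\varepsilon\in[0,\varepsilon_0]$ the Cauchy problem $$\begin{cases}\dfrac{\partial\rho}{\partial t}+\displaystyle\sum_{i=1}^{n}\frac{v^i}{a(t)}\frac{\partial\rho}{\partial x^i}+\rho\Big\{\frac{\dot a(t)}{a(t)}\Big(\frac{u}{c^2}+n\Big)+\frac{u_t}{c^2-u}+\sum_{i=1}^{n}\Big(\frac{\partial v^i}{\partial x^i}\frac{1}{a(t)}+\frac{\partial u}{\partial x^i}\frac{v^i}{a(t)(c^2-u)}\Big)\Big\}=0,\\[2mm] \dfrac{\partial v^i}{\partial t}+\displaystyle\sum_{j=1}^{n}\frac{v^j}{a(t)}\frac{\partial v^i}{\partial x^j}+\frac{\dot a(t)}{a(t)}v^i-\frac{\dot a(t)}{a(t)}\frac{|v|^2}{c^2}v^i=0,\quad i=1,\dots,n,\\ \rho(0,x)=\varepsilon\rho_0(x),\qquad v(0,x)=\varepsilon v_0(x),\end{cases}$$ where $u=|v|^2=\sum_{i=1}^n(v^i)^2$, admits a global classical solution $(\rho,v)\in C^1([0,+\infty)\times\mathbb R^n)$. Moreover, $(\rho,\nabla\rho)$ are bounded for all $t\in[0,+\infty)$, and they decay to zero as $t\to+\infty$.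
   Context: $c>0$ is a constant. The data satisfy $(\rho_0,v_0)\in C^1(\mathbb R^n)\times C^2(\mathbb R^n;\mathbb R^n)$, $\rho_0$ has bounded $C^1$ norm and $v_0$ has bounded $C^2$ norm. $\nabla$ is the gradient in $x$. The scale factor $a:[0,\infty)\to(0,\infty)$ is twice differentiable with $a(0)=1$; dots denote $d/dt$. Assumptions (for all $t\ge0$): - $H_1$: $\dot a(t)>0$ and $\ddot a(t)\ge0$. - $H_2$: $\dot a(t)>0$, $\ddot a(t)<0$, and there is a constant $0<\delta_0<1$ with $a(t)\ge(1+t)^{\frac{1+\delta_0}{2}}$. *)

(* Defs.v *)
From HB Require Import structures.
From mathcomp Require Import all_boot all_order all_algebra.
From mathcomp Require Import all_classical all_reals all_analysis.
Import Order.TTheory GRing.Theory Num.Theory.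
Import numFieldNormedType.Exports.

Set Implicit Arguments.
Unset Strict Implicit.
Unset Printing Implicit Defensive.

Local Open Scope classical_set_scope.
Local Open Scope ring_scope.

(* Functions on [0, +oo) are represented by total functions on R whose values
   at negative times are never used.  The time derivative is therefore the
   limit of difference quotients along s >= 0 only: it is the usual derivative
   at t > 0 and the right derivative at t = 0. *)
Section TimeDerivative.
Context {R : realType}.
Implicit Types (f : R -> R) (t : R).

Definition tslope f t : R -> R := fun s => (f s - f t) / (s - t).

Definition tderivable f t : Prop :=
  cvg (tslope f t @ within [set s : R | 0 <= s] t^').

Definition tderive f t : R :=
  lim (tslope f t @ within [set s : R | 0 <= s] t^').

End TimeDerivative.

Section ScaleFactor.
Context {R : realType}.
Implicit Types a : R -> R.

Definition scale_factor a : Prop :=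
  [/\ a 0 = 1,
      forall t : R, 0 <= t -> 0 < a t,
      forall t : R, 0 <= t -> tderivable a t
    & forall t : R, 0 <= t -> tderivable (tderive a) t].

Definition assumption_H1 a : Prop :=
  forall t : R, 0 <= t -> 0 < tderive a t /\ 0 <= tderive (tderive a) t.

Definition assumption_H2 a : Prop :=
  (forall t : R, 0 <= t -> 0 < tderive a t /\ tderive (tderive a) t < 0) /\
  exists delta0 : R, 0 < delta0 < 1 /\
    forall t : R, 0 <= t -> (1 + t) `^ ((1 + delta0) / 2) <= a t.

End ScaleFactor.

Section SpaceRegularity.
Context {R : realType} {n : nat}.
Implicit Types f : 'rV[R]_n -> R.

Definition partial (i : 'I_n) f : 'rV[R]_n -> R := 'D_(delta_mx 0 i) f.

Definition partially_derivable (i : 'I_n) f (x : 'rV[R]_n) : Prop :=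
  derivable f x (delta_mx 0 i).

Fixpoint Ck (k : nat) f : Prop :=
  continuous f /\
  (if k is k'.+1 then
     forall i : 'I_n,
       (forall x, partially_derivable i f x) /\ Ck k' (partial i f)
   else True).

Fixpoint bounded_Ck_norm (k : nat) f : Prop :=
  bounded_fun f /\
  (if k is k'.+1 then forall i : 'I_n, bounded_Ck_norm k' (partial i f)
   else True).

End SpaceRegularity.

Section SpaceTime.
Context {R : realType} {n : nat}.
Implicit Types (f rho : R -> 'rV[R]_n -> R) (v : R -> 'rV[R]_n -> 'rV[R]_n).

(* The closed half-space [0, +oo) x R^n. *)
Definition spacetime : set (R * 'rV[R]_n) := [set p | 0 <= p.1].

Definition continuous_st f : Prop :=
  {within spacetime, continuous (fun p : R * 'rV[R]_n => f p.1 p.2)}.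

Definition dt f (t : R) (x : 'rV[R]_n) : R := tderive (f ^~ x) t.

Definition dx (i : 'I_n) f (t : R) (x : 'rV[R]_n) : R := partial i (f t) x.

Definition C1_st f : Prop :=
  [/\ continuous_st f,
      forall (t : R) x, 0 <= t -> tderivable (f ^~ x) t,
      continuous_st (dt f),
      forall i (t : R) x, 0 <= t -> partially_derivable i (f t) x
    & forall i, continuous_st (dx i f)].

Definition vcomp v (i : 'I_n) : R -> 'rV[R]_n -> R := fun t x => v t x 0 i.

(* |v|^2, with the Euclidean norm; the library norm on row vectors is the
   maximum norm. *)
Definition sqspeed v : R -> 'rV[R]_n -> R :=
  fun t x => \sum_(i < n) vcomp v i t x ^+ 2.

Definition continuity_equation (c : R) (a : R -> R) rho v (t : R)
    (x : 'rV[R]_n) : Prop :=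
  let u := sqspeed v in
  dt rho t x + \sum_(i < n) vcomp v i t x / a t * dx i rho t x
  + rho t x *
    (tderive a t / a t * (u t x / c ^+ 2 + n%:R)
     + dt u t x / (c ^+ 2 - u t x)
     + \sum_(i < n) (dx i (vcomp v i) t x * (1 / a t)
                     + dx i u t x
                       * (vcomp v i t x / (a t * (c ^+ 2 - u t x)))))
  = 0.

Definition momentum_equation (c : R) (a : R -> R) v (i : 'I_n) (t : R)
    (x : 'rV[R]_n) : Prop :=
  dt (vcomp v i) t x
  + \sum_(j < n) vcomp v j t x / a t * dx j (vcomp v i) t x
  + tderive a t / a t * vcomp v i t x
  - tderive a t / a t * (sqspeed v t x / c ^+ 2) * vcomp v i t x
  = 0.

(* Division by 0 is total in the library, so the condition that the
   denominator c^2 - u does not vanish, without which the equations are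
   meaningless, has to be explicit. *)
Definition global_classical_solution (c : R) (a : R -> R)
    (rho_init : 'rV[R]_n -> R) (v_init : 'rV[R]_n -> 'rV[R]_n) rho v : Prop :=
  [/\ C1_st rho /\ (forall i, C1_st (vcomp v i)),
      forall (t : R) x, 0 <= t -> sqspeed v t x != c ^+ 2,
      forall (t : R) x, 0 <= t -> continuity_equation c a rho v t x,
      forall (t : R) x, 0 <= t -> forall i, momentum_equation c a v i t x
    & forall x, rho 0 x = rho_init x /\ v 0 x = v_init x].

Definition bounded_st f : Prop :=
  exists M : R, forall (t : R) x, 0 <= t -> `|f t x| <= M.

(* Decay in the sup norm over R^n. *)
Definition decays_to_zero f : Prop :=
  forall e : R, 0 < e -> \forall t \near +oo, forall x, `|f t x| <= e.

End SpaceTime.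

(* Main.v *)
Require Import Defs.
From HB Require Import structures.
From mathcomp Require Import all_boot all_order all_algebra.
From mathcomp Require Import all_classical all_reals all_analysis.
From mathcomp Require Import perm ring lra zify.
Import Order.TTheory GRing.Theory Num.Theory.
Import numFieldNormedType.Exports.

(** The velocity equation does not involve the density and has no pressure term,
so it can be integrated along its characteristics dX/dt = v / a. On each of them
the relativistic momentum v / sqrt (1 - |v|^2 / c^2) keeps its direction and is
divided by a. Let w be its initial value as a function of the label y, and let
k = |w|^2 / c^2. Then v = w / sqrt (a^2 + k) on the characteristic issued from
y, which is a segment of a straight line:

  X (t, y) = y + w (y) G (t, k (y)),
  G (t, k) = integral over [0, t] of ds / (a sqrt (a^2 + k)).

Each of the two assumptions on a gives a (t) >= m (1 + t)^((1 + delta) / 2) with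
m, delta > 0 ([scale_factor_growth]), so 1 / a^2 is integrable and G is bounded
together with its derivatives in k. Since w is of order eps, X (t, _) is for
small eps a perturbation of the identity by a map that contracts by 1/2,
uniformly in t >= 0. It is therefore a bijection of R^n, with an inverse B that
is C^1 in (t, x) ([perturbed_identity_inverse]): characteristics never cross,
and v (t, x) is the velocity found at the label B (t, x).

In the continuity equation the terms in the derivatives of u = |v|^2 combine
into the material derivative of u over c^2 - u, known from the first step, and
by Liouville's formula ([jacobian_liouville]) the term div v / a is the
logarithmic derivative of J = det (dX/dy). The equation becomes linear along the
characteristics, with the solution

  rho = eps rho0 (y) sqrt (1 + k) a^(-n) (1 + k / a^2)^(-1/2) / J.

Here J is a polynomial in first derivatives of the flow, hence C^1 because v0 is
C^2, and it is at least 1/2 ([det_near_identity]). Everything except a^(-n) is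
bounded with bounded gradient, so rho and its gradient are O(a^(-n)), and they
tend to 0 because a tends to infinity and n >= 1.

All the functions above are products, sums and smooth functions of a few
elementary ones, so their regularity and bounds are propagated by the stability
properties of the class [bC1]. The time variable is extended to the whole line
by continuing 1 / a to negative times; this gives open space-time R x R^n as the
domain of all functions, and the one-sided time derivatives are recovered at the
end ([C1_st_uncurried]). *)

Set Implicit Arguments.
Unset Strict Implicit.
Unset Printing Implicit Defensive.
Local Open Scope classical_set_scope.
Local Open Scope ring_scope.

(** * Bounded C^1 functions *)

(** The differential is only required to be continuous in each fixed direction;
in finite dimension this is the usual notion, and it is the form in which the
partial derivatives of the statement appear. *)
Definition C1 {R : realType} {E W : normedModType R} (f : E -> W) : Prop :=
  (forall x, differentiable f x) /\ (forall h, continuous (fun x => 'd f x h)).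

Lemma C1_continuous {R : realType} {E W : normedModType R} (f : E -> W) :
  C1 f -> continuous f.
Proof. by move=> [df _] x; exact: differentiable_continuous. Qed.

Section BoundedC1.
Context {R : realType} {E : normedModType R}.
Implicit Types (f g : E -> R) (H : set E).

Definition bounded f : Prop := exists M : R, forall x, `|f x| <= M.

(** The set of directions [H] separates two uses: all directions for functions of
the space variable, purely spatial directions for functions of (t, x), whose
time derivatives (such as that of the scale factor) may be unbounded. *)
Definition bC1 H f : Prop :=
  [/\ C1 f, bounded f & forall h, H h -> bounded (fun x => 'd f x h)].

Lemma bounded_cst (k : R) : bounded (cst k).
Proof. by exists `|k|. Qed.

Lemma boundedD f g : bounded f -> bounded g -> bounded (f \+ g).
Proof.
move=> [M Mf] [N Ng]; exists (M + N) => x.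
by rewrite (le_trans (ler_normD _ _))// lerD.
Qed.

Lemma boundedM f g : bounded f -> bounded g -> bounded (f \* g).
Proof.
move=> [M Mf] [N Ng]; exists (M * N) => x.
by rewrite normrM ler_pM.
Qed.

Lemma bounded_sum (I : Type) (r : seq I) (f : I -> E -> R) :
  (forall i, bounded (f i)) -> bounded (fun x => \sum_(i <- r) f i x).
Proof.
move=> bf; elim: r => [|i r [M IH]].
  by exists 0 => x; rewrite big_nil normr0.
have [N Ni] := bf i; exists (N + M) => x.
by rewrite big_cons (le_trans (ler_normD _ _))// lerD.
Qed.

Lemma eq_bC1 H f g : f =1 g -> bC1 H f -> bC1 H g.
Proof. by move=> /funext ->. Qed.

Lemma bC1_cst H (k : R) : bC1 H (cst k).
Proof.
split; first by split=> [x|h x]; [exact: differentiable_cst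
  | rewrite (_ : (fun x => _) = cst 0); [exact: cvg_cst
  | by apply/funext => y; rewrite diff_cst]].
- exact: bounded_cst.
- by move=> h _; exists 0 => x; rewrite diff_cst normr0.
Qed.

Lemma d_add f g x h : differentiable f x -> differentiable g x ->
  'd (f \+ g) x h = 'd f x h + 'd g x h.
Proof. by move=> df dg; rewrite (diffD df dg). Qed.

Lemma d_mul f g x h : differentiable f x -> differentiable g x ->
  'd (f \* g) x h = f x * 'd g x h + g x * 'd f x h.
Proof. by move=> df dg; rewrite (diffM df dg). Qed.

Lemma bC1D H f g : bC1 H f -> bC1 H g -> bC1 H (f \+ g).
Proof.
move=> [[df cf] bf bdf] [[dg cg] bg bdg].
have E1 h : (fun x => 'd (f \+ g) x h) = (fun x => 'd f x h) \+ (fun x => 'd g x h).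
  by apply/funext => x; rewrite d_add.
split; first (split=> [x|h]; first exact: differentiableD).
- by rewrite E1 => x; apply: cvgD; [exact: cf|exact: cg].
- exact: boundedD.
- by move=> h Hh; rewrite E1; apply: boundedD; [exact: bdf|exact: bdg].
Qed.

Lemma bC1M H f g : bC1 H f -> bC1 H g -> bC1 H (f \* g).
Proof.
move=> [[df cf] bf bdf] [[dg cg] bg bdg].
have E1 h : (fun x => 'd (f \* g) x h) =
    (f \* (fun x => 'd g x h)) \+ (g \* (fun x => 'd f x h)).
  by apply/funext => x; rewrite d_mul.
split; first (split=> [x|h]; first exact: differentiableM).
- rewrite E1 => x; apply: cvgD; apply: cvgM; try exact: cg; try exact: cf.
  + exact: differentiable_continuous.
  + exact: differentiable_continuous.
- exact: boundedM.
- move=> h Hh; rewrite E1; apply: boundedD; apply: boundedM => //.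
  + exact: bdg.
  + exact: bdf.
Qed.

Lemma bC1_sum H (I : Type) (r : seq I) (f : I -> E -> R) :
  (forall i, bC1 H (f i)) -> bC1 H (fun x => \sum_(i <- r) f i x).
Proof.
move=> bf; elim: r => [|i r IH].
  by apply: eq_bC1 (bC1_cst H 0) => x; rewrite big_nil.
by apply: eq_bC1 (bC1D (bf i) IH) => x; rewrite big_cons.
Qed.

Lemma bC1_prod H (I : Type) (r : seq I) (f : I -> E -> R) :
  (forall i, bC1 H (f i)) -> bC1 H (fun x => \prod_(i <- r) f i x).
Proof.
move=> bf; elim: r => [|i r IH].
  by apply: eq_bC1 (bC1_cst H 1) => x; rewrite big_nil.
by apply: eq_bC1 (bC1M (bf i) IH) => x; rewrite big_cons.
Qed.

Lemma bC1X H f n : bC1 H f -> bC1 H (fun x => f x ^+ n).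
Proof.
move=> bf; elim: n => [|n IH].
  by apply: eq_bC1 (bC1_cst H 1) => x; rewrite expr0.
by apply: eq_bC1 (bC1M bf IH) => x; rewrite exprS.
Qed.

Lemma d_comp1 (phi dphi : R -> R) f x h : differentiable f x ->
  is_derive (f x) 1 phi (dphi (f x)) ->
  differentiable (phi \o f) x /\ 'd (phi \o f) x h = dphi (f x) * 'd f x h.
Proof.
move=> df [dp pE]; have dp' : differentiable phi (f x) by exact/derivable1_diffP.
split; first exact: differentiable_comp.
rewrite diff_comp//= -pE deriveE// -[X in _ X = _]mulr1 linearZ/= mulrC.
by [].
Qed.

Lemma bC1_comp H (phi dphi : R -> R) (D : set R) f :
  (forall x, D (f x)) ->
  (forall z, D z -> is_derive z 1 phi (dphi z)) ->
  (forall z, D z -> {for z, continuous dphi}) ->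
  (exists M, forall z, D z -> `|phi z| <= M) ->
  (exists M, forall z, D z -> `|dphi z| <= M) ->
  bC1 H f -> bC1 H (phi \o f).
Proof.
move=> Df ph cph [M Mp] [N Np] [[df cf] bf bdf].
have E1 h : (fun x => 'd (phi \o f) x h) = (dphi \o f) \* (fun x => 'd f x h).
  by apply/funext => x; have [_ ->] := d_comp1 h (df x) (ph _ (Df x)).
split; first split=> [x|h].
- by have [] := @d_comp1 phi dphi f x 0 (df x) (ph _ (Df _)).
- rewrite E1 => x; apply: cvgM; last exact: cf.
  apply: continuous_comp; last exact: cph.
  exact: differentiable_continuous.
- by exists M => x; exact: Mp.
- move=> h Hh; rewrite E1; apply: boundedM; last exact: bdf.
  by exists N => x; exact: Np.
Qed.

End BoundedC1.

(** * Row vectors and differentials *)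

Section Coordinates.
Context {R : realType} {n : nat}.
Implicit Types x : 'rV[R]_n.

Lemma rV_coord_le x i : `|x 0 i| <= `|x|.
Proof.
rewrite /Num.norm/= mx_normrE.
by apply: (le_bigmax _ (fun i : 'I_1 * 'I_n => `|x i.1 i.2|) (0, i)).
Qed.

Lemma rV_norm_le x (M : R) : 0 <= M -> (forall i, `|x 0 i| <= M) -> `|x| <= M.
Proof.
move=> M0 xM; rewrite /Num.norm/= mx_normrE.
by apply/bigmax_leP; split=> // -[i j] _ /=; rewrite ord1.
Qed.

(** Banach's fixed point theorem for [x |-> z - G x]. *)
Lemma rV_fixed_point (G : 'rV[R]_n -> 'rV[R]_n) :
  (forall x y, `|G x - G y| <= 2^-1 * `|x - y|) ->
  forall z, exists x, x + G x = z.
Proof.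
move=> GL z.
pose X : completeNormedModType R :=
  HB.pack 'rV[R]_n (Uniform_isComplete.Build 'rV[R]_n (@cauchy_cvg 'rV[R]_n)).
pose T : X -> X := fun x => z - G x.
have hT : isFun X X [set: X] [set: X] T by split.
pose TF : {fun [set: X] >-> [set: X]} := HB.pack T hT.
have cT : is_contraction TF.
  exists (2^-1)%:nng; split => /=; first by rewrite invf_lt1 ?ltr1n.
  move=> [x y] /= _; rewrite /T/= opprB addrC addrA subrK.
  by rewrite [leLHS]distrC; exact: GL.
have [x _ xE] := banach_fixed_point cT closedT (ex_intro _ (0 : X) I).
by exists x; rewrite {1}xE /= /T subrK.
Qed.

End Coordinates.

Section Differentiability.
Context {R : realType} {E W : normedModType R}.
Implicit Types f : E -> W.

(** The estimates below produce inequalities with explicit constants, so the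
Landau notation in the definition of the differential is unfolded once and for
all, here and in [is_diff_eps]. *)
Lemma differentiable_eps f x : differentiable f x ->
  forall e, 0 < e -> \forall h \near (0 : E),
    `|f (x + h) - f x - 'd f x h| <= e * `|h|.
Proof.
move=> /diff_locallyP[_] /eqaddoP H e e0; have := H e e0.
apply: filterS => h; rewrite /= !fctE /cst /= opprD addrA.
by rewrite (addrC h).
Qed.

Lemma diff_bound f x : differentiable f x ->
  exists2 C, 0 < C & forall h, `|'d f x h| <= C * `|h|.
Proof. by move=> df; apply: linear_lipschitz; exact: diff_continuous. Qed.

Lemma is_diff_eps f x (L : E -> W) : linear L ->
  (exists C, forall h, `|L h| <= C * `|h|) ->
  (forall e, 0 < e -> \forall h \near (0 : E),
    `|f (x + h) - f x - L h| <= e * `|h|) ->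
  is_diff x f L.
Proof.
move=> linL [C LC] Le.
pose LM := GRing.isLinear.Build _ _ _ _ _ linL.
pose LL : {linear E -> W} := HB.pack L LM.
have cL : continuous LL.
  apply/linear_bounded_continuous/linear_boundedP.
  exists C; split; first exact: num_real.
  by move=> r /ltW Cr h; rewrite (le_trans (LC h))// ler_wpM2r.
have fE : f \o shift x = cst (f x) + LL +o_ 0 id.
  apply/eqaddoP => e e0; have := Le e e0.
  apply: filterS => h; rewrite /= !fctE /cst /= opprD addrA.
  by rewrite (addrC h).
have dE := diff_unique cL fE; apply: DiffDef => //.
by apply/diff_locallyP; rewrite dE; split.
Qed.

End Differentiability.

Lemma is_diff_linear {R : realType} {E W : normedModType R} (L : E -> W)
    (C : R) x : linear L -> (forall h, `|L h| <= C * `|h|) -> is_diff x L L.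
Proof.
move=> linL LC; apply: is_diff_eps => //; first by exists C.
move=> e e0; apply: filterE => h.
have -> : L (x + h) = L x + L h.
  by have := linL 1 x h; rewrite !scale1r.
by rewrite (addrC (L x)) addrK subrr normr0 mulr_ge0// ltW.
Qed.

(** * Mean values and partial derivatives *)

(** The sign of [k] is arbitrary, whence the bound on [`|s|] instead of an
interval: below, [k] is a coordinate of an increment. *)
Lemma mvt_direction {R : realType} {E : normedModType R} (f : E -> R)
    (x v : E) (k : R) : (forall y, derivable f y v) ->
  exists2 s : R, `|s| <= `|k| & f (x + k *: v) - f x = k * 'D_v f (x + s *: v).
Proof.
move=> df; pose g (s : R) : R := f (x + s *: v).
have gE (s : R) : is_derive s 1 g ('D_v f (x + s *: v)).
  have E1 : (fun h : R => h^-1 *: ((g \o shift s) (h *: 1) - g s)) =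
     (fun h => h^-1 *: ((f \o shift (x + s *: v)) (h *: v) - f (x + s *: v))).
    apply/funext => h; congr (_ *: (_ - _)); rewrite /g/=; congr f.
    by rewrite [h *: 1]mulr1 scalerDl addrCA.
  by split; rewrite ?/derive ?/derivable E1 //; exact: df.
have gc a b : {within `[a, b], continuous g}.
  apply: continuous_subspaceT => s; apply: differentiable_continuous.
  by apply/derivable1_diffP; case: (gE s).
have [k0|k0|->] := ltrgt0P k.
- have [s /itvP s0k E1] := @MVT R g _ 0 k k0 (fun s _ => gE s) (gc _ _).
  exists s; first by rewrite !ger0_norm ?s0k.
  by move: E1; rewrite /g scale0r addr0 subr0 mulrC.
- have [s /itvP s0k E1] := @MVT R g _ k 0 k0 (fun s _ => gE s) (gc _ _).
  exists s; first by rewrite !ler0_norm ?s0k// ?lerN2 ?s0k.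
  move: E1; rewrite /g scale0r addr0 sub0r => E1.
  by rewrite -opprB E1 mulrN opprK mulrC.
- by exists 0; rewrite ?normr0// scale0r addr0 mul0r subrr.
Qed.

Lemma mvt_along {R : realType} {E : normedModType R} (f : E -> R) x h :
  (forall y, differentiable f y) ->
  exists y, f (x + h) - f x = 'd f y h.
Proof.
move=> df; have [s _] := mvt_direction x 1 (fun y => @diff_derivable _ _ _ f y h (df y)).
rewrite scale1r mul1r deriveE// => ->.
by exists (x + s *: h).
Qed.

Lemma is_diff_sum {R : realType} {E W : normedModType R} (I : Type)
    (r : seq I) (f df : I -> E -> W) x :
  (forall i, is_diff x (f i) (df i)) ->
  is_diff x (\sum_(i <- r) f i) (\sum_(i <- r) df i).
Proof.
move=> fi; elim: r => [|i r IH]; last by rewrite !big_cons; exact: is_diffD.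
by rewrite !big_nil; exact: is_diff_cst.
Qed.

Section RowFunctions.
Context {R : realType} {n : nat} {E : normedModType R}.
Implicit Types F : E -> 'rV[R]_n.

Lemma is_diff_coord F x i : differentiable F x ->
  is_diff x (fun y => F y 0 i) (fun h => 'd F x h 0 i).
Proof.
move=> dF; pose c (M : 'rV[R]_n) : R := M 0 i.
have lc : linear c by move=> k u v; rewrite /c !mxE.
have dc y : is_diff y c c.
  apply: (@is_diff_linear _ _ _ _ 1) => // h.
  by rewrite mul1r; exact: rV_coord_le.
exact: (is_diff_comp (differentiableP dF) (dc (F x))).
Qed.

Lemma is_diff_row F (L : E -> 'rV[R]_n) x :
  (forall i, is_diff x (fun y => F y 0 i) (fun h => L h 0 i)) -> is_diff x F L.
Proof.
move=> dF.
have FE : F = \sum_i (fun y => F y 0 i *: (delta_mx 0 i : 'rV[R]_n)).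
  by apply/funext => y; rewrite fct_sumE -row_sum_delta.
have dFi i : is_diff x (fun y => F y 0 i *: (delta_mx 0 i : 'rV[R]_n))
    (fun h => L h 0 i *: delta_mx 0 i).
  have := @is_diff_comp _ _ _ _ _ _ _ _ x (dF i)
    (@is_diff_scalel R _ (F x 0 i) (delta_mx 0 i : 'rV[R]_n)).
  by [].
have -> : L = \sum_i (fun h => L h 0 i *: (delta_mx 0 i : 'rV[R]_n)).
  by apply/funext => y; rewrite fct_sumE -row_sum_delta.
by rewrite {1}FE; exact: is_diff_sum.
Qed.

Lemma C1_row F : (forall i, C1 (fun y => F y 0 i)) -> C1 F.
Proof.
move=> CF.
have dF x : is_diff x F (fun h => \row_i 'd (fun y => F y 0 i) x h).
  apply: is_diff_row => i.
  apply: is_diff_eq (differentiableP ((CF i).1 x)) _.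
  by apply/funext => h; rewrite mxE.
split=> [x|h]; first by case: (dF x).
have -> : (fun x => 'd F x h) = (fun x => \row_i 'd (fun y => F y 0 i) x h).
  by apply/funext => x; have [_ ->] := dF x.
move=> x; apply/cvgrPdist_le => /= e e0.
have H i : \forall y \near x,
    `|'d (fun y => F y 0 i) x h - 'd (fun y => F y 0 i) y h| <= e.
  by have /cvgrPdist_le := (CF i).2 h x; exact.
have : \forall y \near x, forall i,
    `|'d (fun y => F y 0 i) x h - 'd (fun y => F y 0 i) y h| <= e.
  exact: filter_forall.
apply: filterS => y Hy; apply: rV_norm_le; first exact: ltW.
by move=> i; rewrite !mxE.
Qed.

Lemma C1_coord F i : C1 F -> C1 (fun y => F y 0 i).
Proof.
move=> [dF cF]; split=> [x|h x]; first by have [] := is_diff_coord i (dF x).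
have -> : (fun x => 'd (fun y => F y 0 i) x h) = (fun x => 'd F x h 0 i).
  by apply/funext => y; have [_ ->] := is_diff_coord i (dF y).
move=> y; apply: (@continuous_comp _ _ _ (fun x => 'd F x h)
  (fun M : 'rV[R]_n => M 0 i)); [exact: cF|exact: coord_continuous].
Qed.

End RowFunctions.

Section Partials.
Context {R : realType} {n : nat}.
Implicit Types f : 'rV[R]_n -> R.

(** The vertices of the path from 0 to [h] which changes one coordinate at a time. *)
Definition trunc_row (h : 'rV[R]_n) (m : nat) : 'rV[R]_n :=
  \row_i (if (i < m)%N then h 0 i else 0).

(** A function with continuous partial derivatives is differentiable: along the
path that changes the coordinates of the increment one after the other, every
step is controlled by the mean value theorem in a coordinate direction. *)
Lemma is_diff_partials f x : (forall i y, partially_derivable i f y) ->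
  (forall i, {for x, continuous (partial i f)}) ->
  is_diff x f (fun h => \sum_i h 0 i * partial i f x).
Proof.
move=> df cf; apply: is_diff_eps.
- move=> k u v; rewrite /= scaler_sumr -big_split/=; apply: eq_bigr => i _.
  by rewrite !mxE mulrDl -mulrA.
- exists (\sum_i `|partial i f x|) => h.
  rewrite mulr_suml (le_trans (ler_norm_sum _ _ _))//; apply: ler_sum => i _.
  by rewrite normrM mulrC ler_wpM2l// rV_coord_le.
- move=> e e0; pose e' := e / n.+1%:R.
  have e'0 : 0 < e' by rewrite divr_gt0.
  have : \forall y \near x, forall i, `|partial i f x - partial i f y| <= e'.
    pose P i : set 'rV[R]_n := fun y => `|partial i f x - partial i f y| <= e'.
    apply: (@filter_forall 'rV[R]_n 'I_n P (nbhs x)) => i.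
    by have /cvgrPdist_le/(_ _ e'0) := cf i.
  move=> /nbhs_ballP[d /= d0 Hd]; apply/nbhs_ballP; exists d => //= h.
  rewrite -ball_normE/= sub0r normrN => hd.
  pose z m := f (x + trunc_row h m).
  have -> : f (x + h) - f x = \sum_(i < n) (z i.+1 - z i).
    rewrite -(big_mkord xpredT (fun i => z i.+1 - z i)) telescope_sumr//.
    rewrite /z; congr (f _ - f _).
      by congr +%R; apply/rowP => i; rewrite mxE ltn_ord.
    by rewrite -[LHS]addr0; congr +%R; apply/rowP => i; rewrite !mxE.
  rewrite -sumrB (le_trans (ler_norm_sum _ _ _))//.
  apply: (@le_trans _ _ (\sum_(i < n) e' * `|h|)); last first.
    rewrite sumr_const card_ord -mulr_natl mulrA ler_wpM2r//.
    by rewrite /e' mulrCA ger_pMr// ler_pdivrMr// mul1r ler_nat.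
  apply: ler_sum => i _.
  have -> : z i.+1 = f (x + trunc_row h i + h 0 i *: delta_mx 0 i).
    rewrite /z -addrA; congr (f (_ + _)); apply/rowP => j; rewrite !mxE/=.
    rewrite ltnS leq_eqVlt -val_eqE/=.
    have [E1|] := eqVneq (val j) (val i); last by rewrite mulr0 addr0.
    by rewrite E1 ltnn add0r mulr1; congr (h _ _); apply: val_inj.
  have [s sh ->] := mvt_direction (x + trunc_row h i) (h 0 i) (df i).
  rewrite -/(partial i f) -mulrBr normrM mulrC.
  apply: ler_pM => //; last exact: rV_coord_le.
  rewrite distrC; apply: Hd; rewrite -ball_normE/= opprD addrA opprD addrA.
  rewrite subrr sub0r -opprD normrN (le_lt_trans _ hd)//.
  apply: rV_norm_le => // j; rewrite !mxE/=.
  have [ji|ij] := ltnP j i.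
    by rewrite -val_eqE/= ltn_eqF// mulr0 addr0 rV_coord_le.
  rewrite add0r normrM (le_trans _ (rV_coord_le h i))//.
  rewrite -[leRHS]mulr1 ler_pM//.
  by case: (j == i); rewrite ?normr1 ?normr0.
Qed.

End Partials.

(** * Calculus on space-time *)

Section SpaceTimeCalculus.
Context {R : realType} {n : nat}.
Local Notation V := 'rV[R]_n.
Local Notation E := (R * 'rV[R]_n)%type.

Definition edt : E := (1, 0).
Definition edx (i : 'I_n) : E := (0, delta_mx 0 i).

Lemma spacetime_basis (h : E) :
  h = h.1 *: edt + \sum_i h.2 0 i *: edx i.
Proof.
rewrite [in LHS](surjective_pairing h) [in LHS](row_sum_delta h.2).
have -> : \sum_i h.2 0 i *: edx i = (0, \sum_i h.2 0 i *: delta_mx 0 i) :> E.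
  elim/big_rec2 : _ => // i y1 y2 _ ->.
  by apply: injective_projections => //=; rewrite scaler0 addr0.
apply: injective_projections => /=; last by rewrite scaler0 add0r.
by rewrite addr0 [RHS]mulr1.
Qed.

Lemma d_basis {W : normedModType R} (f : E -> W) p h :
  'd f p h = h.1 *: 'd f p edt + \sum_i h.2 0 i *: 'd f p (edx i).
Proof.
rewrite {1}(spacetime_basis h) linearD linearZ linear_sum; congr (_ + _).
by apply: eq_bigr => i _; rewrite linearZ.
Qed.

Lemma is_diff_fst (p : E) : is_diff p (fst : E -> R) (fst : E -> R).
Proof.
apply: (@is_diff_linear _ _ _ _ 1) => // h.
by rewrite mul1r prod_normE le_max lexx.
Qed.

Lemma is_diff_snd (p : E) : is_diff p (snd : E -> V) (snd : E -> V).
Proof.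
apply: (@is_diff_linear _ _ _ _ 1) => // h.
by rewrite mul1r prod_normE le_max lexx orbT.
Qed.

Lemma fst_continuous (p : E) : {for p, continuous (fst : E -> R)}.
Proof. by apply: differentiable_continuous; have [] := is_diff_fst p. Qed.

Lemma snd_continuous (p : E) : {for p, continuous (snd : E -> V)}.
Proof. by apply: differentiable_continuous; have [] := is_diff_snd p. Qed.

Lemma pair_continuous (T : topologicalType) (f : T -> R) (g : T -> V) t :
  {for t, continuous f} -> {for t, continuous g} ->
  {for t, continuous (fun s => (f s, g s) : E)}.
Proof. by move=> cf cg; exact: (cvg_pair cf cg). Qed.

(** Continuity of the differential in each direction gives joint continuity in
the point and the direction, by expanding the direction on the canonical basis.
This is what makes C^1 functions stable under composition. *)
Lemma C1_jointly_continuous {W : normedModType R} (f : E -> W)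
    (T : topologicalType) (p q : T -> E) t : C1 f ->
  {for t, continuous p} -> {for t, continuous q} ->
  {for t, continuous (fun s => 'd f (p s) (q s))}.
Proof.
move=> [_ cf] cp cq.
have -> : (fun s => 'd f (p s) (q s)) = (fun s => (q s).1 *: 'd f (p s) edt +
    \sum_i (q s).2 0 i *: 'd f (p s) (edx i)).
  by apply/funext => s; exact: d_basis.
have cd h : {for t, continuous (fun s => 'd f (p s) h)}.
  apply: (@continuous_comp _ _ _ p (fun x => 'd f x h)) => //; exact: cf.
have c1 : {for t, continuous (fst \o q)} :=
  continuous_comp cq (@fst_continuous (q t)).
have c2 i : {for t, continuous (fun s => (q s).2 0 i)} :=
  continuous_comp (continuous_comp cq (@snd_continuous (q t)))
    (@coord_continuous _ _ _ 0 i (q t).2).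
apply: (@cvgD _ W _ _ _ (fun s => (q s).1 *: 'd f (p s) edt)).
  exact: cvgZ c1 (cd edt).
apply: cvg_big => [|i _]; first exact: add_continuous.
exact: cvgZ (c2 i) (cd (edx i)).
Qed.

Lemma is_diff_space (f : V -> R) (p : E) : differentiable f p.2 ->
  is_diff p (fun q : E => f q.2) (fun h : E => 'd f (p.2 : V) h.2).
Proof.
by move=> df; exact: (is_diff_comp (is_diff_snd p) (differentiableP df)).
Qed.

Lemma C1_space (f : V -> R) : C1 f -> C1 (fun q : E => f q.2).
Proof.
move=> [df cf]; have dF (p : E) := is_diff_space (df p.2).
split=> [p|h]; first by have [] := dF p.
have -> : (fun p : E => 'd (fun q : E => f q.2) p h) = (fun p => 'd f (p.2 : V) h.2).
  by apply/funext => p; have [_ ->] := dF p.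
move=> p; exact: (continuous_comp (@snd_continuous p) (cf h.2 p.2)).
Qed.

Definition with_time (B : E -> V) (p : E) : E := (p.1, B p).

Lemma is_diff_with_time (B : E -> V) p : differentiable B p ->
  is_diff p (with_time B) (fun h : E => ((h.1, 'd B p h) : E)).
Proof.
by move=> dB; exact: (is_diff_pair (is_diff_fst p) (differentiableP dB)).
Qed.

Lemma is_diff_comp_with_time {W : normedModType R} (f : E -> W) (B : E -> V) p :
  differentiable f (with_time B p) -> differentiable B p ->
  is_diff p (f \o with_time B) (fun h : E => 'd f (with_time B p) ((h.1, 'd B p h) : E)).
Proof.
move=> df dB.
exact: (is_diff_comp (is_diff_with_time dB) (differentiableP df)).
Qed.

Lemma C1_comp_with_time {W : normedModType R} (f : E -> W) (B : E -> V) :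
  C1 f -> C1 B -> C1 (f \o with_time B).
Proof.
move=> Cf CB; have dF p := is_diff_comp_with_time (Cf.1 _) (CB.1 p).
split=> [p|h]; first by have [] := dF p.
have -> : (fun p => 'd (f \o with_time B) p h) =
    (fun p => 'd f (with_time B p) ((h.1, 'd B p h) : E)).
  apply/funext => p; exact: (congr1 (fun g => g h) (diff_val (is_diff_def := dF p))).
move=> p; have [d _] := is_diff_with_time (CB.1 p).
have c1 : {for p, continuous (with_time B)} := differentiable_continuous d.
have c2 := pair_continuous (@cst_continuous _ _ h.1 p) (CB.2 h p).
exact: (C1_jointly_continuous Cf c1 c2).
Qed.

End SpaceTimeCalculus.

(** * Inverse of a small perturbation of the identity *)

Section InverseMap.
Context {R : realType} {n : nat}.
Local Notation V := 'rV[R]_n.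
Local Notation E := (R * 'rV[R]_n)%type.

(** A perturbation of the identity that contracts by 1/2 cannot shrink distances
by more than a factor 2. Injectivity, the continuity of the inverse and the
bounds on its derivative all come from this. *)
Lemma perturbed_identity_expand (G : V -> V) x y :
  (forall x y, `|G x - G y| <= 2^-1 * `|x - y|) ->
  `|x - y| <= 2 * `|(x + G x) - (y + G y)|.
Proof.
move=> GL; have : `|x - y| <= `|(x + G x) - (y + G y)| + 2^-1 * `|x - y|.
  have {1}-> : x - y = (x + G x - (y + G y)) - (G x - G y).
    by apply/rowP => i; rewrite !mxE; ring.
  by rewrite (le_trans (ler_normB _ _))// lerD2l.
lra.
Qed.

Lemma perturbed_identity_lipschitz (F : E -> V) : C1 F ->
  (forall p (h : V), `|'d F p ((0, h) : E)| <= 2^-1 * `|h|) ->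
  forall t x y, `|F (t, x) - F (t, y)| <= 2^-1 * `|x - y|.
Proof.
move=> CF HF t x y; apply: rV_norm_le; first by rewrite mulr_ge0.
move=> i; have [q E1] := mvt_along ((t, y) : E) ((0, x - y) : E) (C1_coord i CF).1.
have tx : ((t, y) : E) + ((0, x - y) : E) = (t, x).
  by apply: injective_projections; rewrite /= ?addr0// addrC subrK.
move: E1; rewrite tx.
have [_ dE] := is_diff_coord i (CF.1 q); rewrite dE => E1.
by rewrite !mxE E1 (le_trans (rV_coord_le _ _)).
Qed.

Variable F : E -> V.
Hypotheses (CF : C1 F)
  (HF : forall p (h : V), `|'d F p ((0, h) : E)| <= 2^-1 * `|h|).

Let dF_lipschitz p (k : R) x y :
  `|'d F p ((k, x) : E) - 'd F p ((k, y) : E)| <= 2^-1 * `|x - y|.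
Proof.
rewrite -linearB/=.
have -> : ((k, x) : E) - ((k, y) : E) = ((0, x - y) : E).
  by apply: injective_projections; rewrite /= ?subrr.
exact: HF.
Qed.

(** [B] is the inverse of [x |-> x + F (t, x)] at each time [t], and [L p] is the
candidate for its differential, obtained by differentiating the identity [BE]. *)
Variable B : E -> V.
Hypothesis BE : forall p : E, B p + F (p.1, B p) = p.2.

Variable L : E -> E -> V.
Hypothesis LE : forall p h : E, L p h + 'd F (with_time B p) ((h.1, L p h) : E) = h.2.

Let L_unique p (h : E) y : y + 'd F (with_time B p) ((h.1, y) : E) = h.2 ->
  y = L p h.
Proof.
move=> yE; apply/eqP; rewrite -subr_eq0 -normr_le0.
have := @perturbed_identity_expand (fun y => 'd F (with_time B p) ((h.1, y) : E))
  y (L p h) (dF_lipschitz (with_time B p) h.1).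
by rewrite yE LE subrr normr0 mulr0.
Qed.

Let L_linear p : linear (L p).
Proof.
move=> k u v; apply/esym/L_unique.
have -> : (((k *: u + v).1, k *: L p u + L p v) : E) =
   k *: ((u.1, L p u) : E) + ((v.1, L p v) : E) by [].
by rewrite linearD linearZ/= addrACA -scalerDr !LE.
Qed.

Let L_bound p (h : E) :
  `|L p h| <= 2 * `|h.2 - 'd F (with_time B p) ((h.1, 0) : E)|.
Proof.
have := @perturbed_identity_expand (fun y => 'd F (with_time B p) ((h.1, y) : E))
  (L p h) 0 (dF_lipschitz (with_time B p) h.1).
by rewrite LE subr0 add0r.
Qed.

Let fst_le (h : E) : `|h.1| <= `|h|.
Proof. by rewrite prod_normE le_max lexx. Qed.

Let snd_le (h : E) : `|h.2| <= `|h|.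
Proof. by rewrite prod_normE le_max lexx orbT. Qed.

Let norm_time (k : R) : `|((k, 0) : E)| <= `|k|.
Proof. by rewrite prod_normE/= normr0 ge_max lexx normr_ge0. Qed.

Let B_lipschitz p : exists2 K, 0 < K &
  \forall h \near (0 : E), `|B (p + h) - B p| <= K * `|h|.
Proof.
have [C C0 HC] := diff_bound (CF.1 (with_time B p)).
exists (2 * (C + 2)); first by rewrite mulr_gt0// addr_gt0.
have /nbhs_ballP[d /= d0 Hd] := differentiable_eps (CF.1 (with_time B p)) ltr01.
apply/nbhs_ballP; exists d => //= h; rewrite -ball_normE/= sub0r normrN => hd.
pose z : E := (h.1, 0).
have zh : `|z| <= `|h| by exact: le_trans (norm_time _) (fst_le _).
have {}Hd : `|F (with_time B p + z) - F (with_time B p)| <= (C + 1) * `|h|.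
  have := Hd z; rewrite -ball_normE/= sub0r normrN => /(_ (le_lt_trans zh hd)).
  set u := F _ - _; set w := 'd F _ z => H1.
  have -> : u = (u - w) + w by rewrite subrK.
  rewrite (le_trans (ler_normD _ _))// addrC mulrDl lerD//.
    by rewrite (le_trans (HC z))// ler_wpM2l// ltW.
  by rewrite (le_trans H1)// !mul1r.
have zE : with_time B p + z = ((p + h).1, B p).
  by apply: injective_projections; rewrite /= ?addr0.
have := @perturbed_identity_expand (fun y => F ((p + h).1, y)) (B (p + h)) (B p)
  (perturbed_identity_lipschitz CF HF (p + h).1).
rewrite BE => /le_trans; apply.
rewrite -mulrA ler_wpM2l//.
have -> : (p + h).2 - (B p + F ((p + h).1, B p)) =
   h.2 - (F (with_time B p + z) - F (with_time B p)).
  rewrite zE /with_time -[(p + h).2]/(p.2 + h.2) -(BE p).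
  by apply/rowP => i; rewrite !mxE; ring.
rewrite (le_trans (ler_normB _ _))//.
have -> : (C + 2) * `|h| = `|h| + (C + 1) * `|h| by ring.
by rewrite lerD ?snd_le.
Qed.

(** Subtracting the equations solved by the increment of [B] and by [L p h] leaves
the first order remainder of [F], which the expansion estimate transfers to
their difference. *)
Let B_diff p : is_diff p B (L p).
Proof.
have [C C0 HC] := diff_bound (CF.1 (with_time B p)).
have [K K0 BK] := B_lipschitz p.
apply: is_diff_eps; first exact: L_linear.
  exists (2 * (1 + C)) => h; rewrite (le_trans (L_bound p h))// -mulrA.
  rewrite ler_wpM2l// mulrDl mul1r (le_trans (ler_normB _ _))// lerD//.
  rewrite (le_trans (HC _))// ler_wpM2l//; first exact: ltW.
  exact: le_trans (norm_time _) (fst_le _).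
move=> e e0; pose e' := e / (2 * (K + 1)).
have K1 : 0 < K + 1 by rewrite addr_gt0.
have e'0 : 0 < e' by rewrite divr_gt0// mulr_gt0.
have /nbhs_ballP[d /= d0 Hd] := differentiable_eps (CF.1 (with_time B p)) e'0.
have /nbhs_ballP[d' /= d'0 Hd'] := BK.
have m0 : 0 < Num.min d' (d / (K + 1)) by rewrite lt_min d'0 divr_gt0.
apply/nbhs_ballP; exists (Num.min d' (d / (K + 1))) => //= h.
rewrite -ball_normE/= sub0r normrN lt_min ltr_pdivlMr// => /andP[hd' hd].
have := Hd' h; rewrite -ball_normE/= sub0r normrN => /(_ hd').
set dl := B (p + h) - B p => dlK.
pose z : E := (h.1, dl).
have zh : `|z| <= `|h| * (K + 1).
  rewrite prod_normE/= ge_max mulrDr mulr1; apply/andP; split.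
    by rewrite (le_trans (fst_le h))// lerDr mulr_ge0// ltW.
  by rewrite (le_trans dlK)// mulrC lerDl.
have := Hd z; rewrite -ball_normE/= sub0r normrN => /(_ (le_lt_trans zh hd)).
have zE : with_time B p + z = ((p + h).1, B (p + h)).
  by apply: injective_projections; rewrite //= /dl addrC subrK.
rewrite zE => H1.
have := @perturbed_identity_expand (fun y => 'd F (with_time B p) ((h.1, y) : E))
  dl (L p h) (dF_lipschitz (with_time B p) h.1).
rewrite LE => /le_trans; apply.
have -> : dl + 'd F (with_time B p) ((h.1, dl) : E) - h.2 =
  - (F ((p + h).1, B (p + h)) - F (with_time B p) - 'd F (with_time B p) z).
  have hE : h.2 = (p + h).2 - p.2 by rewrite /= addrC addKr.
  rewrite hE -(BE p) -(BE (p + h)) /z /dl /with_time.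
  set b := B (p + h); set b0 := B p; set f := F _; set f0 := F _.
  set l := 'd F _ _.
  by apply/rowP => i; rewrite !mxE; ring.
rewrite normrN -ler_pdivlMl// (le_trans H1)//.
rewrite (le_trans (ler_wpM2l (ltW e'0) zh))// /e'.
rewrite le_eqVlt; apply/orP; left; apply/eqP; field.
by rewrite gt_eqF.
Qed.

(** Both [L q h] and [L p h] solve linear problems that differ by the variation of
the differential of [F] applied to the fixed vector [L p h]. *)
Let L_continuous h : continuous (L ^~ h).
Proof.
move=> p; apply/cvgrPdist_le => /= e e0.
have cB : {for p, continuous (with_time B)}.
  have [d _] := is_diff_with_time (@ex_diff _ _ _ _ _ _ _ (B_diff p)).
  exact: differentiable_continuous.
have cd : {for p, continuous (fun q => 'd F (with_time B q) ((h.1, L p h) : E))}.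
  exact: (continuous_comp cB (CF.2 _ _)).
have e20 : 0 < e / 2 by rewrite divr_gt0.
have /cvgrPdist_le/(_ _ e20) := cd.
apply: filterS => q Hq; rewrite distrC.
have := @perturbed_identity_expand (fun y => 'd F (with_time B q) ((h.1, y) : E))
  (L q h) (L p h) (dF_lipschitz (with_time B q) h.1).
rewrite LE => /le_trans; apply.
rewrite -[X in X - _](LE p h) -ler_pdivlMl// mulrC.
by rewrite opprD addrACA subrr add0r.
Qed.

Lemma perturbed_identity_inverse_C1 :
  C1 B /\ forall p (h : V), `|'d B p ((0, h) : E)| <= 2 * `|h|.
Proof.
have LB p := diff_val (is_diff_def := B_diff p).
split.
  split=> [p|h]; first by have [] := B_diff p.
  have -> : (fun p => 'd B p h) = L ^~ h by apply/funext => p; rewrite LB.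
  exact: L_continuous.
move=> p h; rewrite LB (le_trans (L_bound _ _))//=.
by rewrite linear0 subr0.
Qed.

End InverseMap.

(** A global inverse function theorem with a parameter: when [F (t, _)] is
1/2-contracting at every time, [x |-> x + F (t, x)] is a bijection of the
whole space whose inverse is C^1 in [(t, x)] jointly. *)
Theorem perturbed_identity_inverse {R : realType} {n : nat}
    (F : R * 'rV[R]_n -> 'rV[R]_n) : C1 F ->
  (forall p (h : 'rV[R]_n),
     `|'d F p ((0, h) : R * 'rV[R]_n)| <= 2^-1 * `|h|) ->
  exists B : R * 'rV[R]_n -> 'rV[R]_n,
    [/\ C1 B,
        forall p, B p + F (with_time B p) = p.2,
        forall t x, B (t, x + F (t, x)) = x
      & forall p (h : 'rV[R]_n),
          `|'d B p ((0, h) : R * 'rV[R]_n)| <= 2 * `|h| ].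
Proof.
move=> CF HF.
have Flip := perturbed_identity_lipschitz CF HF.
have /choice[B BE] (p : R * 'rV[R]_n) : exists y, y + F (p.1, y) = p.2.
  exact: rV_fixed_point (Flip p.1) p.2.
have HL (ph : (R * 'rV[R]_n) * (R * 'rV[R]_n)) : exists y,
    y + 'd F (with_time B ph.1) ((ph.2.1, y) : R * 'rV[R]_n) = ph.2.2.
  apply: (@rV_fixed_point _ _
    (fun y => 'd F (with_time B ph.1) ((ph.2.1, y) : R * 'rV[R]_n))) => x y.
  rewrite -linearB/=.
  have -> : ((ph.2.1, x) : R * 'rV[R]_n) - ((ph.2.1, y) : R * 'rV[R]_n) =
    ((0, x - y) : R * 'rV[R]_n).
    by apply: injective_projections; rewrite /= ?subrr.
  exact: HF.
have [L LE] := choice HL.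
have [CB dB] := @perturbed_identity_inverse_C1 R n F CF HF B BE
  (fun p h => L (p, h)) (fun p h => LE (p, h)).
exists B; split=> // t x; apply/eqP; rewrite -subr_eq0 -normr_le0.
have := perturbed_identity_expand (B (t, x + F (t, x))) x (Flip t).
by rewrite (BE (t, x + F (t, x))) subrr normr0 mulr0.
Qed.

(** * Primitives on the line *)

Section Primitives.
Context {R : realType}.
Implicit Types f F g G : R -> R.
Local Notation mu := (@lebesgue_measure R).

(** Integrating from -2 works at every real time, because an integrand that
vanishes before -1 contributes nothing to the left of the base point. *)
Lemma primitive_exists f : continuous f -> (forall s, s <= -1 -> f s = 0) ->
  exists2 F : R -> R, F 0 = 0 & forall t : R, is_derive t 1 F (f t).
Proof.
move=> cf f0; pose G t : R := (\int[mu]_(x in `[(-2)%R, t]) f x)%R.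
have intf u : mu.-integrable `[(-2)%R, u] (EFin \o f).
  apply: continuous_compact_integrable; first exact: segment_compact.
  exact: continuous_subspaceT.
have dG (t : R) : is_derive t 1 G (f t).
  have [t2|t2] := ltP (-2) t.
    have tu : t < t + 1 by rewrite ltrDl.
    have [d1 d2] := continuous_FTC1_closed tu (intf _) t2 (cf t).
    by apply: (DeriveDef d1); rewrite -derive1E; exact: d2.
  have -> : f t = 0 by apply: f0; rewrite (le_trans t2)// lerN2 ler1n.
  have h0 : \forall s \near t, cst 0 s = G s.
    have : \forall s \near t, s <= -1.
      have t1 : t < -1 by rewrite (le_lt_trans t2)// ltrN2 ltr1n.
      by have := lt_nbhsl t1; apply: filterS => s /ltW.
    apply: filterS => s s1; rewrite /G /= (@eq_Rintegral _ _ _ mu _ (cst 0)).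
      by rewrite /Rintegral/= integral0.
    move=> x; rewrite inE/= in_itv/= => /andP[_ xs].
    by rewrite f0// (le_trans xs).
  exact: (near_eq_is_derive h0 (is_derive_cst (0 : R) t 1)).
exists (fun t => G t - G 0); first by rewrite subrr.
move=> t; have := is_deriveB (dG t) (is_derive_cst (G 0) t 1).
by rewrite subr0.
Qed.

Lemma nondecreasing_is_derive F f : (forall t : R, is_derive t 1 F (f t)) ->
  (forall t, 0 <= f t) -> forall s t, s <= t -> F s <= F t.
Proof.
move=> dF f0 s t st.
have cF : {within `[s, t], continuous F}.
  apply: continuous_subspaceT => u; apply: differentiable_continuous.
  by apply/derivable1_diffP; case: (dF u).
have [x _ E1] := MVT_segment st (fun x _ => dF x) cF.
by rewrite -subr_ge0 E1 mulr_ge0// subr_ge0.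
Qed.

(** Integral inequalities are used in this differential form, by monotonicity of
[C * G - F] and [C * G + F]. *)
Lemma primitive_dist_le F f G g (C : R) :
  (forall t : R, is_derive t 1 F (f t)) ->
  (forall t : R, is_derive t 1 G (g t)) ->
  0 <= C -> (forall t, 0 <= g t) -> (forall t, `|f t| <= C * g t) ->
  forall s t, `|F t - F s| <= C * `|G t - G s|.
Proof.
move=> dF dG C0 g0 fg.
have h1 (t : R) : is_derive t 1 (fun t => C * G t - F t) (C * g t - f t).
  exact: (is_deriveB (is_deriveZ C (dG t)) (dF t)).
have h2 (t : R) : is_derive t 1 (fun t => C * G t + F t) (C * g t + f t).
  exact: (is_deriveD (is_deriveZ C (dG t)) (dF t)).
have m1 : forall s t, s <= t -> C * G s - F s <= C * G t - F t.
  apply: (nondecreasing_is_derive h1) => t.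
  by have := fg t; rewrite ler_norml subr_ge0 => /andP[].
have m2 : forall s t, s <= t -> C * G s + F s <= C * G t + F t.
  apply: (nondecreasing_is_derive h2) => t.
  have := fg t; rewrite ler_norml => /andP[+ _]; lra.
have m3 := nondecreasing_is_derive dG g0.
move=> s t; wlog st : s t / s <= t.
  move=> H; have [/H//|/ltW/H] := leP s t.
  by rewrite distrC [X in _ <= _ * X]distrC.
have := m1 _ _ st; have := m2 _ _ st; have := m3 _ _ st => h3 h4 h5.
rewrite [X in _ <= _ * X]ger0_norm ?subr_ge0// ler_norml.
by apply/andP; split; lra.
Qed.

End Primitives.

(** * Derivatives of the inverse square root *)

Section InverseSqrtDerivatives.
Context {R : realType}.
Implicit Types z : R.

Definition isqrt1 z : R := (Num.sqrt (1 + z))^-1.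

Fixpoint isqrt1_coef (j : nat) : R :=
  if j is i.+1 then - ((2 * i + 1)%:R / 2) * isqrt1_coef i else 1.

(** The [j]-th derivative of [isqrt1]. *)
Definition isqrt1_iter (j : nat) z : R := isqrt1_coef j * isqrt1 z ^+ (2 * j + 1).

Lemma isqrt1_gt0 z : -1 < z -> 0 < isqrt1 z.
Proof. by move=> z1; rewrite invr_gt0 sqrtr_gt0; lra. Qed.

Lemma isqrt1_sqr z : -1 < z -> isqrt1 z ^+ 2 = (1 + z)^-1.
Proof. by move=> z1; rewrite exprVn sqr_sqrtr//; lra. Qed.

Lemma isqrt1_le1 z : 0 <= z -> isqrt1 z <= 1.
Proof.
move=> z0; have z1 : -1 < z by lra.
have r0 := ltW (isqrt1_gt0 z1).
by rewrite -(@expr_le1 _ 2 _ _ r0)// isqrt1_sqr// invf_le1; lra.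
Qed.

Lemma isqrt1_le2 z : -2^-1 <= z -> isqrt1 z <= 2.
Proof.
move=> z0; have z1 : -1 < z by lra.
have r0 := ltW (isqrt1_gt0 z1).
rewrite -(@ler_pXn2r _ 2)// ?nnegrE// isqrt1_sqr//.
by rewrite invf_ple ?posrE; lra.
Qed.

Lemma is_derive_isqrt1 z : -1 < z ->
  is_derive z 1 isqrt1 (- 2^-1 * isqrt1 z ^+ 3).
Proof.
move=> z1; have z0 : 0 < 1 + z by lra.
have d1 : is_derive z 1 (fun z => 1 + z) 1.
  by have := is_deriveD (is_derive_cst (1 : R) z 1) (is_derive_id z 1); rewrite add0r.
have d2 := @is_derive1_comp _ _ _ _ _ _ (is_derive1_sqrt z0) d1.
have s0 : Num.sqrt (1 + z) != 0 by rewrite gt_eqF// sqrtr_gt0.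
have d3 := @is_deriveV R (fun z => Num.sqrt (1 + z)) z _ 1 s0 d2.
apply: is_derive_eq d3 _.
rewrite /isqrt1 /= mulr1 exprVn -[LHS]/(_ * _).
by field.
Qed.

Lemma is_derive_isqrt1_iter j z : -1 < z ->
  is_derive z 1 (isqrt1_iter j) (isqrt1_iter j.+1 z).
Proof.
move=> z1.
have d := is_deriveZ (isqrt1_coef j) (is_deriveX (2 * j + 1) (is_derive_isqrt1 z1)).
have -> : isqrt1_iter j = isqrt1_coef j *: isqrt1 ^+ (2 * j + 1).
  by apply/funext => y; rewrite /isqrt1_iter fctE.
suff -> : isqrt1_iter j.+1 z = isqrt1_coef j *: (((2 * j + 1)%:R *
    isqrt1 z ^+ (2 * j + 1).-1) *: (- 2^-1 * isqrt1 z ^+ 3)) by exact: d.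
have E1 : (2 * j.+1 + 1 = (2 * j) + 3)%N by lia.
rewrite /isqrt1_iter/= -[RHS]/(_ * (_ * _)) E1 exprD addn1/=.
by field.
Qed.

Lemma continuous_isqrt1_iter j z : -1 < z -> {for z, continuous (isqrt1_iter j)}.
Proof.
move=> z1; apply: differentiable_continuous; apply/derivable1_diffP.
by case: (is_derive_isqrt1_iter j z1).
Qed.

Lemma isqrt1_iter_le1 j z : 0 <= z -> `|isqrt1_iter j z| <= `|isqrt1_coef j|.
Proof.
move=> z0; have z1 : -1 < z by lra.
rewrite normrM ler_piMr// normrX exprn_ile1// ger0_norm ?isqrt1_le1//.
by rewrite ltW// isqrt1_gt0.
Qed.

Lemma isqrt1_iter_le2 j z : -2^-1 <= z ->
  `|isqrt1_iter j z| <= `|isqrt1_coef j| * 2 ^+ (2 * j + 1).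
Proof.
move=> z0; have z1 : -1 < z by lra.
rewrite normrM ler_wpM2l// normrX lerXn2r ?nnegrE//.
by rewrite gtr0_norm ?isqrt1_gt0// isqrt1_le2.
Qed.

Lemma isqrt1_iter_mvt j z z' : 0 <= z -> 0 <= z' ->
  exists x, [/\ 0 <= x, `|x - z| <= `|z' - z| &
    isqrt1_iter j z' - isqrt1_iter j z = (z' - z) * isqrt1_iter j.+1 x].
Proof.
have H (y y' : R) : 0 <= y -> y <= y' -> exists x, [/\ y <= x, x <= y' &
    isqrt1_iter j y' - isqrt1_iter j y = (y' - y) * isqrt1_iter j.+1 x].
  move=> y0 yy; have dz x : x \in `]y, y'[ ->
      is_derive x 1 (isqrt1_iter j) (isqrt1_iter j.+1 x).
    by rewrite in_itv/= => /andP[zx _]; apply: is_derive_isqrt1_iter; lra.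
  have cz : {within `[y, y'], continuous (isqrt1_iter j)}.
    apply: derivable_within_continuous => x; rewrite in_itv/= => /andP[zx _].
    have x1 : -1 < x by lra.
    by case: (is_derive_isqrt1_iter j x1).
  have [x] := MVT_segment yy dz cz; rewrite in_itv/= => /andP[zx xz] E1.
  by exists x; split => //; rewrite mulrC.
move=> z0 z'0; have [zz|/ltW zz] := leP z z'.
  have [x [zx xz E1]] := H _ _ z0 zz; exists x; split=> //; first by lra.
  by rewrite !ger0_norm ?subr_ge0// lerD2r.
have [x [zx xz E1]] := H _ _ z'0 zz; exists x; split=> //; first by lra.
  by rewrite !ler0_norm ?subr_le0// lerN2 lerD2r.
by rewrite -opprB E1 -mulNr opprB.
Qed.

Lemma isqrt1_iter_dist j z z' : 0 <= z -> 0 <= z' ->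
  `|isqrt1_iter j z' - isqrt1_iter j z| <= `|isqrt1_coef j.+1| * `|z' - z|.
Proof.
move=> z0 z'0; have [x [x0 _ ->]] := isqrt1_iter_mvt j z0 z'0.
by rewrite normrM mulrC ler_wpM2r// isqrt1_iter_le1.
Qed.

Lemma isqrt1_iter_taylor j z z' : 0 <= z -> 0 <= z' ->
  `|isqrt1_iter j z' - isqrt1_iter j z - (z' - z) * isqrt1_iter j.+1 z|
    <= `|isqrt1_coef j.+2| * (z' - z) ^+ 2.
Proof.
move=> z0 z'0; have [x [x0 xz ->]] := isqrt1_iter_mvt j z0 z'0.
rewrite -mulrBr normrM mulrC.
rewrite (le_trans (ler_wpM2r _ (isqrt1_iter_dist _ z0 x0)))//.
by rewrite -mulrA ler_wpM2l// -real_normK ?num_real// expr2 ler_wpM2r.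
Qed.

End InverseSqrtDerivatives.

(** * Time integrals along the characteristics *)

Section FlowIntegrals.
Context {R : realType} (b : R -> R).

(** With [b = 1 / a], this is the [j]-th derivative in [k] of
1 / (a sqrt (a^2 + k)), the speed at which a characteristic moves per unit of
initial momentum. *)
Definition flow_rate (j : nat) (k s : R) : R :=
  b s ^+ (2 * j + 2) * isqrt1_iter j (k * b s ^+ 2).

(** [Q j k t] is the integral over [[0, t]] of the [j]-th derivative of the speed;
only [k >= 0] matters, since [k] is a squared momentum. *)
Definition flow_integral (Q : nat -> R -> R -> R) : Prop :=
  forall j k, 0 <= k ->
    Q j k 0 = 0 /\ forall t : R, is_derive t 1 (Q j k) (flow_rate j k t).

Hypotheses (cb : continuous b) (b01 : forall s, 0 <= b s <= 1).

Let b0 s : 0 <= b s. Proof. by case/andP: (b01 s). Qed.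
Let b1 s : b s <= 1. Proof. by case/andP: (b01 s). Qed.
Let kb0 k s : 0 <= k -> 0 <= k * b s ^+ 2.
Proof. by move=> k0; rewrite mulr_ge0// exprn_ge0. Qed.
Let bX_le j s : b s ^+ (2 * j + 2) <= b s ^+ 2.
Proof. by rewrite exprD ler_piMl ?exprn_ge0// exprn_ile1. Qed.
Let bX_le1 j s : b s ^+ j <= 1.
Proof. by rewrite exprn_ile1. Qed.

Lemma continuous_flow_rate j k : 0 <= k -> continuous (flow_rate j k).
Proof.
move=> k0 s.
have cX m : {for s, continuous (fun s => b s ^+ m)}.
  apply: (@continuous_comp _ _ _ b (fun x => x ^+ m)); first exact: cb.
  exact: exprn_continuous.
have c2 : {for s, continuous (fun s => k * b s ^+ 2)}.
  by apply: cvgM; [exact: cvg_cst|exact: cX].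
have c3 : {for k * b s ^+ 2, continuous (@isqrt1_iter R j)}.
  by apply: continuous_isqrt1_iter; rewrite (lt_le_trans _ (kb0 _ k0))// ltrN10.
exact: (cvgM (cX _) (continuous_comp c2 c3)).
Qed.

Lemma flow_rate_le j k s : 0 <= k ->
  `|flow_rate j k s| <= `|isqrt1_coef j| * b s ^+ 2.
Proof.
move=> k0; rewrite normrM mulrC ler_pM// ?isqrt1_iter_le1 ?kb0//.
by rewrite ger0_norm ?exprn_ge0 ?bX_le.
Qed.

Lemma flow_rate_taylor j k k' s : 0 <= k -> 0 <= k' ->
  `|flow_rate j k' s - flow_rate j k s - (k' - k) * flow_rate j.+1 k s|
    <= `|isqrt1_coef j.+2| * (k' - k) ^+ 2 * b s ^+ 2.
Proof.
move=> k0 k'0.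
have H := isqrt1_iter_taylor j (kb0 s k0) (kb0 s k'0).
have -> : flow_rate j k' s - flow_rate j k s - (k' - k) * flow_rate j.+1 k s =
  b s ^+ (2 * j + 2) * (isqrt1_iter j (k' * b s ^+ 2)
   - isqrt1_iter j (k * b s ^+ 2)
   - (k' * b s ^+ 2 - k * b s ^+ 2) * isqrt1_iter j.+1 (k * b s ^+ 2)).
  have E1 : b s ^+ (2 * j.+1 + 2) = b s ^+ (2 * j + 2) * b s ^+ 2.
    by rewrite -exprD; congr (_ ^+ _); lia.
  by rewrite /flow_rate E1; set B := b s ^+ (2 * j + 2); ring.
rewrite normrM mulrC; apply: ler_pM => //; last by rewrite ger0_norm ?exprn_ge0 ?bX_le.
rewrite (le_trans H)// -mulrBl ler_wpM2l// exprMn.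
apply: ler_piMr; first exact: sqr_ge0.
by rewrite -exprM.
Qed.

(** [I] is the primitive of [b ^ 2]. Its boundedness is the only integrability
property of the scale factor needed for the flow: every [flow_rate j k], as
well as its Taylor remainders in [k], is dominated by a multiple of [b ^ 2]. *)
Variables (Q : nat -> R -> R -> R) (I : R -> R) (M : R).
Hypotheses (HQ : flow_integral Q)
  (I0 : I 0 = 0) (dI : forall t : R, is_derive t 1 I (b t ^+ 2))
  (IM : forall t, `|I t| <= M).

Let b20 s : 0 <= b s ^+ 2. Proof. exact: sqr_ge0. Qed.

Lemma flow_integral_bound j k t : 0 <= k -> `|Q j k t| <= `|isqrt1_coef j| * M.
Proof.
move=> k0; have [Q0 dQ] := HQ j k0.
have := primitive_dist_le dQ dI (normr_ge0 _) b20
  (fun s => flow_rate_le j s k0) 0 t.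
by rewrite Q0 I0 !subr0 => /le_trans; apply; rewrite ler_wpM2l.
Qed.

Lemma flow_integral_time_dist j k s t : 0 <= k ->
  `|Q j k t - Q j k s| <= `|isqrt1_coef j| * `|t - s|.
Proof.
move=> k0; have [Q0 dQ] := HQ j k0.
apply: (primitive_dist_le dQ (fun t => is_derive_id t 1)) => // u.
by rewrite (le_trans (flow_rate_le j u k0))// ler_wpM2l// bX_le1.
Qed.

Lemma flow_integral_taylor j k k' t : 0 <= k -> 0 <= k' ->
  `|Q j k' t - Q j k t - (k' - k) * Q j.+1 k t|
    <= `|isqrt1_coef j.+2| * M * (k' - k) ^+ 2.
Proof.
move=> k0 k'0; have [Q0 dQ] := HQ j k0; have [Q'0 dQ'] := HQ j k'0.
have [Q10 dQ1] := HQ j.+1 k0.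
have dd (s : R) : is_derive s 1
    (fun s => Q j k' s - Q j k s - (k' - k) * Q j.+1 k s)
    (flow_rate j k' s - flow_rate j k s - (k' - k) * flow_rate j.+1 k s) :=
  is_deriveB (is_deriveB (dQ' s) (dQ s)) (is_deriveZ (k' - k) (dQ1 s)).
have := primitive_dist_le dd dI (mulr_ge0 (normr_ge0 _) (sqr_ge0 _)) b20
  (fun s => flow_rate_taylor j s k0 k'0) 0 t.
rewrite Q0 Q'0 I0 Q10 subrr mulr0 !subr0 => /le_trans; apply.
by rewrite mulrAC ler_wpM2r ?sqr_ge0// ler_wpM2l.
Qed.

Context {n : nat} (kappa : 'rV[R]_n -> R).
Local Notation E := (R * 'rV[R]_n)%type.
Hypotheses (kappa0 : forall x, 0 <= kappa x) (C1k : C1 kappa).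

Definition flow_along j (p : E) : R := Q j (kappa p.2) p.1.

(** Differentiation under the integral sign: the Taylor formula in [k] of the
integrand can be integrated with a uniform remainder, and the remaining cross
term is of second order because [Q j.+1] is Lipschitz in time. *)
Lemma is_diff_flow_along j (p : E) : is_diff p (flow_along j)
  (fun h : E => h.1 * flow_rate j (kappa p.2) p.1
           + flow_along j.+1 p * 'd kappa (p.2 : 'rV[R]_n) h.2).
Proof.
set k := kappa p.2.
have k0 : 0 <= k by exact: kappa0.
have [_ dQ] := HQ j k0.
have dQ1 : is_diff (p.1) (Q j k) (fun h : R => h * flow_rate j k p.1).
  have [d1 d2] := dQ p.1; apply: DiffDef; first exact/derivable1_diffP.
  rewrite diff1E; last exact/derivable1_diffP.
  by apply/funext => h; rewrite derive1E d2.
have dtime : is_diff p (fun q : E => Q j k q.1) (fun h : E => h.1 * flow_rate j k p.1).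
  exact: (is_diff_comp (is_diff_fst p) dQ1).
have dspace : is_diff p (fun q : E => kappa q.2)
    (fun h : E => 'd kappa (p.2 : 'rV[R]_n) h.2).
  exact: is_diff_space (C1k.1 _).
pose rem (q : E) : R := flow_along j q - Q j k q.1 - (kappa q.2 - k) * Q j.+1 k p.1.
have drem : is_diff p rem (fun _ : E => 0).
  have [C C0 HC] := diff_bound (C1k.1 (p.2)).
  pose K1 := `|isqrt1_coef j.+2 : R| * M; pose K2 := `|isqrt1_coef j.+1 : R|.
  have M0 : 0 <= M by exact: le_trans (IM 0).
  have K10 : 0 <= K1 by rewrite mulr_ge0.
  pose D := C + 1; have D0 : 0 < D by rewrite addr_gt0.
  pose K := (K1 * D + K2) * D + 1.
  have K0 : 0 < K.
    by rewrite ltr_pwDr// mulr_ge0// ?(ltW D0)// addr_ge0 ?normr_ge0// mulr_ge0// ltW.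
  have remp : rem p = 0 by rewrite /rem /flow_along -/k; ring.
  apply: is_diff_eps.
  - by move=> c u v; rewrite scaler0 addr0.
  - by exists 0 => h; rewrite normr0 mul0r.
  move=> e e0.
  have /nbhs_ballP[d /= d0 Hd] := differentiable_eps (C1k.1 p.2) ltr01.
  have m0 : 0 < Num.min d (e / K) by rewrite lt_min d0 divr_gt0.
  apply/nbhs_ballP; exists (Num.min d (e / K)) => //= h.
  rewrite -ball_normE/= sub0r normrN lt_min ltr_pdivlMr// => /andP[hd he].
  have h1 : `|h.1| <= `|h| by rewrite prod_normE le_max lexx.
  have h2 : `|h.2| <= `|h| by rewrite prod_normE le_max lexx orbT.
  have := Hd h.2; rewrite -ball_normE/= sub0r normrN => /(_ (le_lt_trans h2 hd)).
  rewrite mul1r => Hk.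
  have dk : `|kappa (p + h).2 - k| <= D * `|h|.
    rewrite -[X in `|X|](subrK ('d kappa (p.2 : 'rV[R]_n) h.2)).
    rewrite (le_trans (ler_normD _ _))//.
    rewrite mulrDl addrC mul1r lerD//; last exact: le_trans Hk h2.
    by rewrite (le_trans (HC _))// ler_wpM2l// ltW.
  rewrite remp !subr0.
  have remE : rem (p + h) = (Q j (kappa (p + h).2) (p + h).1 - Q j k (p + h).1
      - (kappa (p + h).2 - k) * Q j.+1 k (p + h).1)
      + (kappa (p + h).2 - k) * (Q j.+1 k (p + h).1 - Q j.+1 k p.1).
    by rewrite /rem /flow_along; ring.
  rewrite remE (le_trans (ler_normD _ _))//.
  have r1 := flow_integral_taylor j (p + h).1 k0 (kappa0 (p + h).2).
  have r2 := flow_integral_time_dist j.+1 p.1 (p + h).1 k0.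
  have E1 : (p + h).1 - p.1 = h.1 by rewrite /= addrC addKr.
  rewrite E1 in r2.
  rewrite (le_trans (lerD r1 (lexx _)))// [X in _ + X]normrM.
  rewrite -/K1 -(real_normK (num_real (_ - k))).
  set x := `|kappa _ - k| in dk *.
  have x0 : 0 <= x by exact: normr_ge0.
  have xh : K1 * x ^+ 2 <= K1 * (D * `|h|) ^+ 2.
    by rewrite ler_wpM2l// lerXn2r ?nnegrE// (le_trans x0).
  have yh : x * `|Q j.+1 k (p + h).1 - Q j.+1 k p.1| <= (D * `|h|) * (K2 * `|h|).
    by rewrite ler_pM// (le_trans r2)// ler_wpM2l.
  rewrite (le_trans (lerD xh yh))//.
  have -> : K1 * (D * `|h|) ^+ 2 + D * `|h| * (K2 * `|h|) =
     (K - 1) * `|h| * `|h| by rewrite /K; ring.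
  rewrite ler_wpM2r// (le_trans _ (ltW he))// mulrC ler_wpM2l//.
  by rewrite gerDl lerN10.
have -> : flow_along j = rem + ((fun q : E => Q j k q.1) +
    Q j.+1 k p.1 *: ((fun q : E => kappa q.2) - cst k)).
  by apply/funext => q; rewrite !fctE /rem /flow_along -[_ *: _]/(_ * _) /=; ring.
have := is_diffD drem (is_diffD dtime (is_diffZ (Q j.+1 k p.1)
  (is_diffB dspace (is_diff_cst k p)))).
move=> H; apply: is_diff_eq H _; apply/funext => h.
by rewrite !fctE add0r subr0.
Qed.

Lemma C1_flow_along j : C1 (flow_along j).
Proof.
have dF := is_diff_flow_along.
split=> [p|h]; first by have [] := dF j p.
have -> : (fun p => 'd (flow_along j) p h) = (fun p : E =>
    h.1 * flow_rate j (kappa p.2) p.1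
    + flow_along j.+1 p * 'd kappa (p.2 : 'rV[R]_n) h.2).
  apply/funext => p.
  exact: (congr1 (fun g => g h) (diff_val (is_diff_def := dF j p))).
move=> p.
have ck : {for p, continuous (fun q : E => kappa q.2)}.
  exact: (continuous_comp (@snd_continuous _ _ p) (C1_continuous C1k (x := p.2))).
have cb1 : {for p, continuous (fun q : E => b q.1)}.
  exact: (continuous_comp (@fst_continuous _ _ p) (cb (x := p.1))).
have cX m : {for p, continuous (fun q : E => b q.1 ^+ m)}.
  exact: (continuous_comp cb1 (@exprn_continuous R m (b p.1))).
have c2 : {for p, continuous (fun q : E => kappa q.2 * b q.1 ^+ 2)}.
  exact: (cvgM ck (cX 2)).
have c3 : {for kappa p.2 * b p.1 ^+ 2, continuous (@isqrt1_iter R j)}.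
  apply: continuous_isqrt1_iter.
  by rewrite (lt_le_trans _ (kb0 _ (kappa0 _)))// ltrN10.
have c4 : {for p, continuous (fun q : E => flow_rate j (kappa q.2) q.1)}.
  exact: (cvgM (cX _) (continuous_comp c2 c3)).
have c5 : {for p, continuous (flow_along j.+1)}.
  by apply: differentiable_continuous; have [] := dF j.+1 p.
have c6 : {for p, continuous (fun q : E => 'd kappa (q.2 : 'rV[R]_n) h.2)}.
  exact: (continuous_comp (@snd_continuous _ _ p) (C1k.2 h.2 (p.2))).
exact: (cvgD (cvgM (@cst_continuous _ _ h.1 p) c4) (cvgM c5 c6)).
Qed.

Lemma bC1_flow_along j : bC1 setT kappa ->
  bC1 [set h : E | h.1 = 0] (flow_along j).
Proof.
move=> [_ _ bdk]; split; first exact: C1_flow_along.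
- by exists (`|isqrt1_coef j| * M) => p; apply: flow_integral_bound.
- move=> h /= h0; have [N HN] := bdk h.2 Logic.I.
  exists (`|isqrt1_coef j.+1| * M * N) => p.
  rewrite (congr1 (fun g => g h) (diff_val (is_diff_def := is_diff_flow_along j p))).
  rewrite h0 mul0r add0r normrM ler_pM//.
  exact: flow_integral_bound.
Qed.

End FlowIntegrals.

(** * One-sided time derivatives *)

Section OneSidedDerivatives.
Context {R : realType}.
Implicit Types (f g : R -> R) (t d : R).

Lemma is_derive_eps f t d : is_derive t 1 f d <->
  forall e, 0 < e -> exists2 r, 0 < r & forall s, `|s - t| < r ->
    `|f s - f t - (s - t) * d| <= e * `|s - t|.
Proof.
split=> [[df dE] e e0|H].
  have /derivable1_diffP df' := df.
  have /nbhs_ballP[r /= r0 Hr] := differentiable_eps df' e0.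
  exists r => // s st; have := Hr (s - t).
  rewrite -ball_normE/= sub0r normrN => /(_ st).
  by rewrite diff1E// derive1E dE (addrC t) subrK.
have D : is_diff t f (fun h : R => h * d).
  apply: is_diff_eps.
  - by move=> k u v; rewrite mulrDl -mulrA.
  - by exists `|d| => h; rewrite normrM mulrC.
  - move=> e e0; have [r r0 Hr] := H e e0.
    apply/nbhs_ballP; exists r => //= h; rewrite -ball_normE/= sub0r normrN => hr.
    by have := Hr (t + h); rewrite (addrC t) addrK; exact.
have [df dE] := D; apply: DeriveDef; first exact/derivable1_diffP.
by rewrite deriveE// dE mul1r.
Qed.

Lemma tslope_cvg_eps f t d :
  (tslope f t @ within [set s : R | 0 <= s] t^' --> d) <->
  forall e, 0 < e -> exists2 r, 0 < r & forall s, 0 <= s -> `|s - t| < r ->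
    `|f s - f t - (s - t) * d| <= e * `|s - t|.
Proof.
split=> [/cvgrPdist_le H e e0|H].
  have /nbhs_ballP[r /= r0 Hr] := H _ e0.
  exists r => // s s0 st; have [->|snt] := eqVneq s t.
    by rewrite !subrr mul0r subrr normr0 mulr0.
  have {Hr} := Hr s; rewrite -ball_normE/= distrC => /(_ st snt s0).
  rewrite /tslope distrC => Hs.
  have st0 : s - t != 0 by rewrite subr_eq0.
  have -> : f s - f t - (s - t) * d = ((f s - f t) / (s - t) - d) * (s - t).
    by field.
  by rewrite normrM ler_wpM2r.
apply/cvgrPdist_le => e e0; have [r r0 Hr] := H e e0.
apply/nbhs_ballP; exists r => //= s; rewrite -ball_normE/= distrC => st snt s0.
have st0 : s - t != 0 by rewrite subr_eq0.
rewrite /tslope distrC; have := Hr s s0 st.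
have -> : f s - f t - (s - t) * d = ((f s - f t) / (s - t) - d) * (s - t).
  by field.
by rewrite normrM ler_pM2r// normr_gt0.
Qed.

Lemma within_dnbhs_proper t : 0 <= t -> ProperFilter (within [set s : R | 0 <= s] t^').
Proof.
move=> t0; apply: Build_ProperFilter_ex => A /nbhs_ballP[r /= r0 Hr].
exists (t + r / 2); apply: Hr.
- by rewrite -ball_normE/= opprD addrA subrr sub0r normrN ger0_norm; lra.
- by rewrite -subr_eq0 addrAC subrr add0r gt_eqF// divr_gt0.
- by rewrite /=; lra.
Qed.

Lemma tderive_val f t d : 0 <= t ->
  (tslope f t @ within [set s : R | 0 <= s] t^' --> d) ->
  tderivable f t /\ tderive f t = d.
Proof.
move=> t0 H; split; first by apply/cvg_ex; exists d.
by apply: cvg_lim => //; exact: within_dnbhs_proper.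
Qed.

Lemma is_derive_tderive f t d : 0 <= t -> is_derive t 1 f d ->
  tderivable f t /\ tderive f t = d.
Proof.
move=> t0 /is_derive_eps H; apply: tderive_val => //; apply/tslope_cvg_eps => e e0.
by have [r r0 Hr] := H e e0; exists r => // s _; exact: Hr.
Qed.

(** Continuing a function given on [[0, +oo)] to negative times turns one-sided
derivatives at 0 into ordinary ones, so that only two-sided calculus is used
for the solution itself. *)
Definition glue0 f g t : R := if 0 <= t then f t else g t.

Lemma is_derive_glue f g (f' dg : R -> R) t :
  (forall t, 0 <= t -> tslope f t @ within [set s : R | 0 <= s] t^' --> f' t) ->
  (forall t : R, is_derive t 1 g (dg t)) -> f 0 = g 0 -> f' 0 = dg 0 ->
  is_derive t 1 (glue0 f g) (glue0 f' dg t).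
Proof.
move=> df dg' fg0 d0; apply/is_derive_eps => e e0; rewrite /glue0.
have /is_derive_eps/(_ _ e0)[r2 r20 H2] := dg' t.
have [t0|t0] := leP 0 t; last first.
  exists (Num.min r2 (- t)); first by rewrite lt_min r20 oppr_gt0.
  move=> s; rewrite lt_min => /andP[sr]; rewrite ltr_norml => /andP[_ st].
  have -> : (0 <= s) = false by apply/negbTE; rewrite -ltNge; lra.
  exact: H2.
have /tslope_cvg_eps/(_ _ e0)[r1 r10 H1] := df t t0.
have [t0'|t0'] := ltP 0 t.
  exists (Num.min r1 t); first by rewrite lt_min r10.
  move=> s; rewrite lt_min => /andP[sr]; rewrite ltr_norml => /andP[st _].
  have s0 : 0 <= s by lra.
  by rewrite s0; exact: H1.
have tE : t = 0 by apply/eqP; rewrite eq_le t0'.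
rewrite tE in H1 H2 *.
exists (Num.min r1 r2); first by rewrite lt_min r10.
move=> s; rewrite lt_min => /andP[sr1 sr2]; case: ifP => s0; first exact: H1.
by rewrite fg0 d0; exact: H2.
Qed.

Lemma continuous_glue f g :
  (forall t, 0 <= t -> forall e, 0 < e -> exists2 r, 0 < r & forall s, 0 <= s ->
     `|s - t| < r -> `|f s - f t| <= e) ->
  continuous g -> f 0 = g 0 -> continuous (glue0 f g).
Proof.
move=> cf cg fg0 t; apply/cvgrPdist_le => e e0; apply/nbhs_normP; rewrite /glue0.
have /cvgrPdist_le/(_ _ e0)/nbhs_normP[r2 /= r20 H2] := cg t.
have {}H2 s : `|s - t| < r2 -> `|g t - g s| <= e.
  by move=> st; apply: H2; rewrite /= distrC.
have [t0|t0] := leP 0 t; last first.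
  exists (Num.min r2 (- t)); first by rewrite /= lt_min r20 oppr_gt0.
  move=> s; rewrite /= distrC lt_min => /andP[sr]; rewrite ltr_norml => /andP[_ st].
  have -> : (0 <= s) = false by apply/negbTE; rewrite -ltNge; lra.
  exact: H2.
have [r1 r10 H1] := cf t t0 e e0.
have [t0'|t0'] := ltP 0 t.
  exists (Num.min r1 t); first by rewrite /= lt_min r10.
  move=> s; rewrite /= distrC lt_min => /andP[sr]; rewrite ltr_norml => /andP[st _].
  have s0 : 0 <= s by lra.
  by rewrite s0 distrC; exact: H1.
have tE : t = 0 by apply/eqP; rewrite eq_le t0'.
rewrite tE in H1 H2 *.
exists (Num.min r1 r2); first by rewrite /= lt_min r10.
move=> s; rewrite /= distrC lt_min => /andP[sr1 sr2].
case: ifP => s0; first by rewrite distrC; exact: H1.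
by rewrite fg0; exact: H2.
Qed.

Lemma tderivable_right_continuous f t d :
  (tslope f t @ within [set s : R | 0 <= s] t^' --> d) ->
  forall e, 0 < e -> exists2 r, 0 < r & forall s, 0 <= s ->
     `|s - t| < r -> `|f s - f t| <= e.
Proof.
move=> /tslope_cvg_eps /(_ 1 ltr01)[r r0 Hr] e e0.
have d1 : 0 < 1 + `|d| by rewrite ltr_pwDl.
exists (Num.min r (e / (1 + `|d|))); first by rewrite lt_min r0 divr_gt0.
move=> s s0; rewrite lt_min ltr_pdivlMr// => /andP[/(Hr s s0) sr se].
rewrite -(subrK ((s - t) * d) (f s - f t)) (le_trans (ler_normD _ _))//.
rewrite (le_trans (lerD sr (lexx _)))// normrM.
by apply: ltW; apply: le_lt_trans se; rewrite mulrDr mulr1 mul1r.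
Qed.

Lemma tMVT f s t : (forall t, 0 <= t -> tderivable f t) -> 0 <= s -> s <= t ->
  exists x, [/\ s <= x, x <= t & f t - f s = tderive f x * (t - s)].
Proof.
move=> df s0 st.
pose g u := f 0 + u * tderive f 0.
have dg (u : R) : is_derive u 1 g (tderive f 0).
  apply/is_derive_eps => e e0; exists 1 => // v _.
  have -> : g v - g u - (v - u) * tderive f 0 = 0 by rewrite /g; ring.
  by rewrite normr0 mulr_ge0// ltW.
have fg0 : f 0 = g 0 by rewrite /g mul0r addr0.
have D (u : R) : is_derive u 1 (glue0 f g) (glue0 (tderive f) (cst (tderive f 0)) u).
  exact: is_derive_glue df dg fg0 erefl.
have cF : {within `[s, t], continuous (glue0 f g)}.
  apply: continuous_subspaceT => u; apply: differentiable_continuous.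
  by apply/derivable1_diffP; case: (D u).
have [x] := MVT_segment st (fun x _ => D x) cF.
rewrite in_itv/= => /andP[sx xt]; rewrite /glue0 s0 (le_trans s0 st) (le_trans s0 sx).
by move=> E1; exists x.
Qed.

End OneSidedDerivatives.

(** * The scale factor *)

Section ScaleFactorConsequences.
Context {R : realType} (a : R -> R).
Hypothesis ha : scale_factor a.

Let a0 : a 0 = 1. Proof. by case: ha. Qed.
Let a_gt0 t : 0 <= t -> 0 < a t. Proof. by case: ha => _ H _ _; exact: H. Qed.
Let da t : 0 <= t -> tderivable a t. Proof. by case: ha => _ _ H _; exact: H. Qed.
Let dda t : 0 <= t -> tderivable (tderive a) t.
Proof. by case: ha => _ _ _ H; exact: H. Qed.

(** Both assumptions are used only through this growth. When [a] is convex it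
dominates its tangent at 0, which gives [delta = 1]. *)
Lemma scale_factor_growth : assumption_H1 a \/ assumption_H2 a ->
  (forall t, 0 <= t -> 0 < tderive a t) /\
  exists m delta : R, [/\ 0 < m, 0 < delta &
    forall t, 0 <= t -> m * (1 + t) `^ ((1 + delta) / 2) <= a t].
Proof.
case=> [H1|[H2 [d [/andP[d0 d1] Hd]]]]; split=> [t t0|].
- by have [] := H1 t t0.
- have p0 : 0 < tderive a 0 by have [] := H1 0 (lexx _).
  exists (Num.min 1 (tderive a 0)), 1; split=> //; first by rewrite lt_min p0 ltr01.
  move=> t t0; have -> : (1 + 1) / 2 = 1 :> R by field.
  have t1 : 0 <= 1 + t by lra.
  rewrite powRr1//; have [x [x0 xt E1]] := tMVT da (lexx 0) t0.
  have [y [y0 yx E2]] := tMVT dda (lexx 0) x0.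
  have q0 : tderive a 0 <= tderive a x.
    by rewrite -subr_ge0 E2 subr0 mulr_ge0//; have [] := H1 y y0.
  have : tderive a 0 * t <= a t - 1.
    by rewrite -a0 E1 subr0 ler_wpM2r.
  have : Num.min 1 (tderive a 0) * 1 <= 1 by rewrite mulr1 ge_min lexx.
  have : Num.min 1 (tderive a 0) * t <= tderive a 0 * t.
    by rewrite ler_wpM2r// ge_min lexx orbT.
  by rewrite mulrDr; lra.
- by have [] := H2 t t0.
- by exists 1, d; split=> // t t0; rewrite mul1r; exact: Hd.
Qed.

Hypothesis da_gt0 : forall t, 0 <= t -> 0 < tderive a t.

Lemma scale_factor_ge1 t : 0 <= t -> 1 <= a t.
Proof.
move=> t0; have [x [x0 xt E1]] := tMVT da (lexx 0) t0.
by rewrite -subr_ge0 -a0 E1 subr0 mulr_ge0// ltW// da_gt0.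
Qed.

Lemma tslope_cvg_inv t : 0 <= t ->
  tslope (fun s => (a s)^-1) t @ within [set s : R | 0 <= s] t^' -->
    - tderive a t / a t ^+ 2.
Proof.
move=> t0.
pose g (s : R) := 1 + s * tderive a 0.
have dg (u : R) : is_derive u 1 g (tderive a 0).
  apply/is_derive_eps => e e0; exists 1 => // v _.
  have -> : g v - g u - (v - u) * tderive a 0 = 0 by rewrite /g; ring.
  by rewrite normr0 mulr_ge0// ltW.
have fg0 : a 0 = g 0 by rewrite /g mul0r addr0.
have D : is_derive t 1 (glue0 a g) (glue0 (tderive a) (cst (tderive a 0)) t).
  exact: is_derive_glue da dg fg0 erefl.
have at0 : glue0 a g t != 0 by rewrite /glue0 t0 gt_eqF// a_gt0.
have /is_derive_eps H := is_deriveV at0 D.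
apply/tslope_cvg_eps => e e0; have [r r0 Hr] := H e e0.
exists r => // s s0 st; have := Hr s st; rewrite /glue0 s0 t0.
rewrite -[_ *: _]/(_ * _) mulNr; congr (`| _ - _ * _| <= _).
by rewrite mulrC mulNr.
Qed.

(** The continuation by [1 + a'(0) (1 - e^t)] is C^1 at 0 and bounded. *)
Definition inv_scale : R -> R :=
  glue0 (fun t => (a t)^-1) (fun t => 1 + tderive a 0 * (1 - expR t)).

Definition inv_scale_deriv : R -> R :=
  glue0 (fun t => - tderive a t / a t ^+ 2) (fun t => - tderive a 0 * expR t).

Lemma is_derive_inv_scale (t : R) : is_derive t 1 inv_scale (inv_scale_deriv t).
Proof.
apply: is_derive_glue.
- exact: tslope_cvg_inv.
- move=> s.
  have d := is_deriveD (is_derive_cst (1 : R) s 1) (is_deriveZ (tderive a 0)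
    (is_deriveB (is_derive_cst (1 : R) s 1) (is_derive_expR s))).
  rewrite (_ : - tderive a 0 * expR s = 0 + tderive a 0 *: (0 - expR s)).
    exact: d.
  by rewrite add0r sub0r -[_ *: _]/(_ * _) mulrN mulNr.
- by rewrite a0 expR0 subrr mulr0 addr0 invr1.
- by rewrite a0 expR0 expr1n divr1 mulr1.
Qed.

Lemma continuous_inv_scale_deriv : continuous inv_scale_deriv.
Proof.
have c1 : continuous (glue0 (tderive a) (fun t => tderive a 0 * expR t)).
  apply: continuous_glue.
  - by move=> t t0; exact: tderivable_right_continuous (dda t0).
  - by move=> s; apply: cvgM; [exact: cvg_cst|exact: continuous_expR].
  - by rewrite expR0 mulr1.
have c2 : continuous (glue0 (fun t => (a t)^-1) (cst 1)).
  apply: continuous_glue.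
  - by move=> t t0; exact: tderivable_right_continuous (tslope_cvg_inv t0).
  - by move=> s; exact: cvg_cst.
  - by rewrite a0 invr1.
have -> : inv_scale_deriv = fun t =>
    - glue0 (tderive a) (fun t => tderive a 0 * expR t) t
    * (glue0 (fun t => (a t)^-1) (cst 1) t * glue0 (fun t => (a t)^-1) (cst 1) t).
  apply/funext => t; rewrite /inv_scale_deriv /glue0 /cst; case: ifP => _.
    by rewrite -expr2 exprVn.
  by rewrite !mulr1 mulNr.
move=> t; apply: cvgM; first by apply: cvgN; exact: c1.
by apply: cvgM; exact: c2.
Qed.

Lemma inv_scale_bounded : exists N, forall t, `|inv_scale t| <= N.
Proof.
have p0 := da_gt0 (lexx 0).
exists (1 + tderive a 0) => t; rewrite /inv_scale /glue0; case: ifP => t0.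
  have a1 := scale_factor_ge1 t0.
  rewrite ger0_norm ?invr_ge0 ?(ltW (a_gt0 t0))//.
  by rewrite (le_trans (_ : _ <= 1))// ?invf_le1 ?a_gt0// lerDl ltW.
have t0' : t <= 0 by apply: ltW; rewrite ltNge t0.
have e1 : expR t <= 1 by rewrite -expR0 ler_expR.
have e0 := expR_gt0 t.
have h1 : 0 <= 1 - expR t by rewrite subr_ge0.
have h2 : 1 - expR t <= 1 by rewrite gerBl ltW.
rewrite ger0_norm; first by rewrite lerD2l ger_pMr.
by rewrite addr_ge0// mulr_ge0// ltW.
Qed.

(** A second continuation of [1 / a], used inside the integrals over time: it is
only continuous, but vanishes before -1, so that its square has a primitive
that is bounded on the whole line. *)
Definition cut_inv_scale : R -> R :=
  glue0 (fun t => (a t)^-1) (fun t => Num.max 0 (1 + t)).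

Lemma continuous_cut_inv_scale : continuous cut_inv_scale.
Proof.
apply: continuous_glue.
- by move=> t t0; exact: tderivable_right_continuous (tslope_cvg_inv t0).
- move=> s; apply: continuous_max; first exact: cvg_cst.
  by apply: cvgD; [exact: cvg_cst|exact: cvg_id].
- by rewrite a0 invr1 addr0 max_r.
Qed.

Lemma cut_inv_scale_01 s : 0 <= cut_inv_scale s <= 1.
Proof.
rewrite /cut_inv_scale /glue0; case: ifP => s0.
  by rewrite invr_ge0 (ltW (a_gt0 s0)) invf_le1 ?a_gt0// scale_factor_ge1.
have s0' : s < 0 by rewrite ltNge s0.
by rewrite le_max lexx ge_max ler01/=; lra.
Qed.

Lemma cut_inv_scale_early s : s <= -1 -> cut_inv_scale s = 0.
Proof.
move=> s1; rewrite /cut_inv_scale /glue0; case: ifP => s0; first by lra.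
by rewrite max_l//; lra.
Qed.

Lemma cut_inv_scale_sqr_primitive (m delta : R) : 0 < m -> 0 < delta ->
  (forall t, 0 <= t -> m * (1 + t) `^ ((1 + delta) / 2) <= a t) ->
  exists I : R -> R, [/\ I 0 = 0,
    (forall t : R, is_derive t 1 I (cut_inv_scale t ^+ 2))
    & exists M, forall t, `|I t| <= M].
Proof.
move=> m0 d0 Hm.
have cb2 : continuous (fun t => cut_inv_scale t ^+ 2).
  move=> t; apply: (@continuous_comp _ _ _ cut_inv_scale (fun x => x ^+ 2)).
    exact: continuous_cut_inv_scale.
  exact: exprn_continuous.
have b20 s : s <= -1 -> cut_inv_scale s ^+ 2 = 0.
  by move=> /cut_inv_scale_early ->; rewrite expr0n.
have [I I0 dI] := primitive_exists cb2 b20.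
have nI := nondecreasing_is_derive dI (fun t => sqr_ge0 _).
exists I; split=> //; exists (1 + m ^- 2 / delta) => t.
have md0 : 0 <= m ^- 2 / delta by rewrite divr_ge0 ?invr_ge0 ?sqr_ge0 ?ltW.
have [t0|t0] := leP 0 t.
  have It0 : 0 <= I t by rewrite -I0 nI.
  rewrite ger0_norm//.
  (* [g] is nonincreasing on [[0, t]]: [1 / a ^ 2 <= m ^ -2 (1 + s) ^ (-1 - delta)]. *)
  pose g (s : R) := I s + m ^- 2 / delta * (1 + s) `^ (- delta).
  have dg (s : R) : -1 < s -> is_derive s 1 g
      (cut_inv_scale s ^+ 2 - m ^- 2 * (1 + s) `^ (- delta - 1)).
    move=> s1; have s1' : 0 < 1 + s by lra.
    have d1 : is_derive s 1 (fun z => 1 + z) 1.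
      by have := is_deriveD (is_derive_cst (1 : R) s 1) (is_derive_id s 1); rewrite add0r.
    have d2 := @is_derive1_comp _ _ _ _ _ _ (is_derive1_powR (- delta) s1') d1.
    have d3 := is_deriveD (dI s) (is_deriveZ (m ^- 2 / delta) d2).
    rewrite (_ : cut_inv_scale s ^+ 2 - _ = cut_inv_scale s ^+ 2 +
      (m ^- 2 / delta) *: (- delta * (1 + s) `^ (- delta - 1) * 1)).
      exact: d3.
    rewrite -[_ *: _]/(_ * _); congr (_ + _); field.
    by rewrite gt_eqF//= gt_eqF.
  have cg : {within `[0, t], continuous g}.
    apply: derivable_within_continuous => s; rewrite in_itv/= => /andP[s0 _].
    have s1 : -1 < s by lra.
    by case: (dg s s1).
  have dg' s : s \in `]0, t[ -> is_derive s 1 g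
      (cut_inv_scale s ^+ 2 - m ^- 2 * (1 + s) `^ (- delta - 1)).
    by rewrite in_itv/= => /andP[s0 _]; apply: dg; lra.
  have [s] := MVT_segment t0 dg' cg; rewrite in_itv/= => /andP[s0 _] E1.
  have : g t - g 0 <= 0.
    rewrite E1 subr0 mulr_le0_ge0// subr_le0 /cut_inv_scale /glue0 s0.
    have s1 : 0 < 1 + s by lra.
    rewrite exprVn -[leRHS]invrK lef_pV2 ?posrE ?exprn_gt0 ?a_gt0//; last first.
      by rewrite invr_gt0 mulr_gt0 ?invr_gt0 ?exprn_gt0 ?powR_gt0.
    rewrite invfM invrK -powRN opprD !opprK.
    have -> : (1 + s) `^ (delta + 1) = ((1 + s) `^ ((1 + delta) / 2)) ^+ 2.
      rewrite -powR_mulrn ?powR_ge0// -powRrM; congr (_ `^ _); by field.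
    rewrite -exprMn lerXn2r ?nnegrE ?Hm//.
      by rewrite mulr_ge0 ?powR_ge0// ltW.
    by rewrite ltW// a_gt0.
  rewrite /g I0 add0r addr0 powR1 mulr1.
  have : 0 <= m ^- 2 / delta * (1 + t) `^ (- delta) by rewrite mulr_ge0 ?powR_ge0.
  lra.
have It0 : I t <= 0 by rewrite -I0 nI// ltW.
rewrite ler0_norm//.
(* For negative times, [I] is compared with the exponential. *)
have dg (s : R) : is_derive s 1 (expR \- I) (expR s - cut_inv_scale s ^+ 2).
  exact: is_deriveB (is_derive_expR s) (dI s).
have cg : {within `[t, 0], continuous (expR \- I)}.
  apply: derivable_within_continuous => s _; by case: (dg s).
have [s] := MVT_segment (ltW t0) (fun s _ => dg s) cg.
rewrite in_itv/= => /andP[_ s0] E1.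
have : 0 <= (expR \- I) 0 - (expR \- I) t.
  rewrite E1 mulr_ge0//; last by lra.
  rewrite subr_ge0 (@le_trans _ _ (cut_inv_scale s))//.
    by have /andP[b0 b1] := cut_inv_scale_01 s; rewrite expr2 ler_piMr.
  rewrite /cut_inv_scale /glue0; case: ifP => s0'.
    have -> : s = 0 by apply/eqP; rewrite eq_le s0.
    by rewrite a0 invr1 expR0.
  by rewrite ge_max expR_ge0/= expR_ge1Dx.
rewrite /= I0 expR0; have := expR_gt0 t; lra.
Qed.

Lemma scale_factor_unbounded (m delta : R) : 0 < m -> 0 < delta ->
  (forall t, 0 <= t -> m * (1 + t) `^ ((1 + delta) / 2) <= a t) ->
  forall K, 0 < K -> exists T, 0 <= T /\ forall t, T <= t -> K <= a t.
Proof.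
move=> m0 d0 Hm K K0; exists ((K / m) ^+ 2); split; first exact: sqr_ge0.
move=> t Tt; have t0 : 0 <= t by rewrite (le_trans _ Tt)// sqr_ge0.
apply: le_trans (Hm t t0); rewrite -ler_pdivrMl// mulrC.
have t1 : 1 <= 1 + t by lra.
apply: (@le_trans _ _ ((1 + t) `^ 2^-1)); last by rewrite ler_powR//; lra.
have Km0 : 0 <= K / m by rewrite divr_ge0// ltW.
rewrite -(@ler_pXn2r _ 2)// ?nnegrE ?powR_ge0//.
rewrite -[leRHS]powR_mulrn ?powR_ge0// -powRrM mulVf ?pnatr_eq0//.
by rewrite powRr1; lra.
Qed.

End ScaleFactorConsequences.

(** * Determinants *)

Section Determinants.
Context {R : realType} {n : nat}.

Lemma det_near_identity : exists2 eta : R, 0 < eta & forall A : 'M[R]_n,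
  (forall i j, `|A i j - (i == j)%:R| <= eta) -> 2^-1 <= \det A.
Proof.
have cdet : continuous (fun A : 'M[R]_n => \det A).
  have cp (s : 'S_n) : continuous (fun A : 'M[R]_n => \prod_i A i (s i)).
    apply: continuous_big => [|i _]; first exact: mul_continuous.
    exact: coord_continuous.
  apply: continuous_big => [|s _]; first exact: add_continuous.
  have c1 : continuous (fun _ : 'M[R]_n => (-1) ^+ s : R).
    by move=> A; exact: cst_continuous.
  by move=> A; exact: (continuousM (c1 A) (cp s A)).
have h0 : 0 < 2^-1 :> R by rewrite invr_gt0.
have /cvgrPdist_lt/(_ _ h0) := cdet 1%:M.
rewrite det1 => /nbhs_normP[r /= r0 Hr].
exists (r / 2); first by rewrite divr_gt0.
move=> A HA; suff /Hr : ball_ Num.norm 1%:M r A.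
  by rewrite ltr_norml => /andP[]; lra.
rewrite /= (@le_lt_trans _ _ (r / 2))//; last by lra.
rewrite /Num.norm/= mx_normrE; apply/bigmax_leP; split; first by lra.
by move=> [i j] _ /=; rewrite !mxE distrC.
Qed.

Context {E : normedModType R}.

Lemma bC1_det (H : set E) (m : 'I_n -> 'I_n -> E -> R) :
  (forall i j, bC1 H (m i j)) ->
  bC1 H (fun p => \det (\matrix_(i, j) m i j p)).
Proof.
move=> Hm; apply: (@eq_bC1 _ _ H (fun p => \sum_(s : 'S_n) (-1) ^+ s *
   \prod_i m i (s i) p)).
  move=> p; rewrite /determinant; apply: eq_bigr => s _; congr (_ * _).
  by apply: eq_bigr => i _; rewrite mxE.
apply: bC1_sum => s; apply: (bC1M (f := cst ((-1) ^+ s))); first exact: bC1_cst.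
by apply: bC1_prod => i; exact: Hm.
Qed.

Lemma is_diff_prod (I : eqType) (r : seq I) (f df : I -> E -> R) x : uniq r ->
  (forall i, is_diff x (f i) (df i)) ->
  is_diff x (fun y => \prod_(i <- r) f i y)
    (fun h => \sum_(k <- r) df k h * \prod_(i <- r | i != k) f i x).
Proof.
move=> + Df; elim: r => [_|a r IH /= /andP[ar /IH{}IH]].
  have -> : (fun y : E => \prod_(i <- [::]) f i y) = cst 1.
    by apply/funext => y; rewrite big_nil.
  have -> : (fun h => \sum_(k <- [::]) df k h * \prod_(i <- [::] | i != k) f i x) =
    (fun _ : E => 0) by apply/funext => h; rewrite big_nil.
  exact: is_diff_cst.
have -> : (fun y : E => \prod_(i <- a :: r) f i y) =
    f a * (fun y => \prod_(i <- r) f i y).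
  by apply/funext => y; rewrite big_cons.
apply: is_diff_eq (is_diffM (Df a) IH) _; apply/funext => h.
rewrite !fctE big_cons big_cons eqxx/= addrC; congr (_ + _).
  rewrite -[LHS]/(_ * _) mulrC; congr (_ * _); rewrite big_seq [RHS]big_seq_cond.
  apply: eq_bigl => i; rewrite andb_idr// => ir.
  by apply: contraNneq ar => <-.
rewrite -[LHS]/(f a x * _) mulr_sumr [LHS]big_seq [RHS]big_seq; apply: eq_bigr => k kr.
rewrite big_cons ifT; first by rewrite mulrCA.
by apply: contraNneq ar => ->.
Qed.

(** Jacobi's formula: by multilinearity, the derivative is the sum over [i] of the
determinants in which row [i] is differentiated, expanded along that row. *)
Lemma is_diff_det (m dm : 'I_n -> 'I_n -> E -> R) x :
  (forall i j, is_diff x (m i j) (dm i j)) ->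
  is_diff x (fun p => \det (\matrix_(i, j) m i j p))
    (fun h => \sum_i \sum_j dm i j h * cofactor (\matrix_(i, j) m i j x) i j).
Proof.
move=> Dm.
have -> : (fun p => \det (\matrix_(i, j) m i j p)) =
    \sum_(s : 'S_n) ((-1) ^+ s : R) *: (fun p => \prod_i m i (s i) p).
  apply/funext => p; rewrite fct_sumE /determinant; apply: eq_bigr => s _.
  by congr (_ * _); apply: eq_bigr => i _; rewrite mxE.
have D := is_diff_sum (index_enum 'S_n) (fun s : 'S_n => is_diffZ ((-1) ^+ s)
  (is_diff_prod (index_enum_uniq 'I_n) (fun i => Dm i (s i)))).
apply: is_diff_eq D _; apply/funext => h; rewrite fct_sumE.
transitivity (\sum_(s : 'S_n) \sum_k (-1) ^+ s *
    (dm k (s k) h * \prod_(i | i != k) m i (s i) x)).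
  by apply: eq_bigr => s _; rewrite -mulr_sumr.
rewrite exchange_big/=; apply: eq_bigr => k _.
pose A : 'M[R]_n := \matrix_(i, j) m i j x.
pose B : 'M[R]_n := \matrix_(i, j) if i == k then dm k j h else m i j x.
have -> : \sum_j dm k j h * cofactor A k j = \det B.
  rewrite (expand_det_row B k); apply: eq_bigr => j _; rewrite !mxE eqxx.
  congr (_ * (_ * \det _)); apply/matrixP => i l; rewrite !mxE.
  by rewrite eq_sym (negbTE (neq_lift k i)).
rewrite /determinant; apply: eq_bigr => s _; congr (_ * _).
rewrite [RHS](bigD1 k)//= mxE eqxx; congr (_ * _).
by apply: eq_bigr => i ik; rewrite mxE (negbTE ik).
Qed.

End Determinants.

(** * Regularity of the data *)

Section TwiceC1.
Context {R : realType} {E : normedModType R}.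
Implicit Types f g : E -> R.

Definition bC2 f : Prop :=
  bC1 setT f /\ forall h, bC1 setT (fun x => 'd f x h).

Lemma eq_bC2 f g : f =1 g -> bC2 f -> bC2 g.
Proof. by move=> /funext ->. Qed.

Lemma bC2_cst (k : R) : bC2 (cst k).
Proof.
split=> [|h]; first exact: bC1_cst.
by apply: eq_bC1 (bC1_cst _ 0) => x; rewrite diff_cst.
Qed.

Lemma bC2D f g : bC2 f -> bC2 g -> bC2 (f \+ g).
Proof.
move=> [bf df] [bg dg]; split=> [|h]; first exact: bC1D.
have [[Df _] _ _] := bf; have [[Dg _] _ _] := bg.
by apply: eq_bC1 (bC1D (df h) (dg h)) => x; rewrite d_add.
Qed.

Lemma bC2M f g : bC2 f -> bC2 g -> bC2 (f \* g).
Proof.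
move=> [bf df] [bg dg]; split=> [|h]; first exact: bC1M.
have [[Df _] _ _] := bf; have [[Dg _] _ _] := bg.
by apply: eq_bC1 (bC1D (bC1M bf (dg h)) (bC1M bg (df h))) => x; rewrite d_mul.
Qed.

Lemma d_scale (k : R) f x h : differentiable f x ->
  'd (fun y => k * f y) x h = k * 'd f x h.
Proof. by move=> df; exact: (congr1 (fun u => u h) (diffZ k df)). Qed.

Lemma bC2Z (k : R) f : bC2 f -> bC2 (fun x => k * f x).
Proof. exact: bC2M (bC2_cst k). Qed.

Lemma bC2_sum (I : Type) (r : seq I) (f : I -> E -> R) :
  (forall i, bC2 (f i)) -> bC2 (fun x => \sum_(i <- r) f i x).
Proof.
move=> bf; elim: r => [|i r IH].
  by apply: eq_bC2 (bC2_cst 0) => x; rewrite big_nil.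
by apply: eq_bC2 (bC2D (bf i) IH) => x; rewrite big_cons.
Qed.

Lemma bC1_isqrt1_iter H j f : (forall x, -2^-1 <= f x) -> bC1 H f ->
  bC1 H (isqrt1_iter j \o f).
Proof.
move=> f0; have h1 (z : R) : -2^-1 <= z -> -1 < z by move=> ?; lra.
apply: (@bC1_comp _ _ _ _ (isqrt1_iter j.+1) [set z | -2^-1 <= z]) => //.
- by move=> z /= /h1; exact: is_derive_isqrt1_iter.
- by move=> z /= /h1; exact: continuous_isqrt1_iter.
- by eexists => z /=; exact: isqrt1_iter_le2.
- by eexists => z /=; exact: isqrt1_iter_le2.
Qed.

Lemma d_isqrt1_iter j f x h : (forall x, -2^-1 <= f x) -> differentiable f x ->
  'd (isqrt1_iter j \o f) x h = isqrt1_iter j.+1 (f x) * 'd f x h.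
Proof.
move=> f0 df; have h1 : -1 < f x by have := f0 x; lra.
by have [_ ->] := d_comp1 h df (is_derive_isqrt1_iter j h1).
Qed.

Lemma bC2_isqrt1_iter j f : (forall x, -2^-1 <= f x) -> bC2 f ->
  bC2 (isqrt1_iter j \o f).
Proof.
move=> f0 [bf df]; split=> [|h]; first exact: bC1_isqrt1_iter.
have [[Df _] _ _] := bf.
apply: eq_bC1 (bC1M (bC1_isqrt1_iter j.+1 f0 bf) (df h)) => x.
by rewrite d_isqrt1_iter.
Qed.

End TwiceC1.

Section InitialRegularity.
Context {R : realType} {n : nat}.
Implicit Types f : 'rV[R]_n -> R.

Lemma bounded_funE f : bounded_fun f -> bounded f.
Proof.
move=> [M [_ HM]]; exists (M + 1) => x.
by apply: (HM (M + 1)) => //; rewrite ltrDl.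
Qed.

Lemma Ck1_bC1 f : Ck 1 f -> bounded_Ck_norm 1 f -> bC1 setT f.
Proof.
move=> [cf df] [bf bdf].
have D x : is_diff x f (fun h => \sum_i h 0 i * partial i f x).
  apply: is_diff_partials => i; first exact: (df i).1.
  exact: (df i).2.1.
have E1 h : (fun x => 'd f x h) = (fun x => \sum_i h 0 i * partial i f x).
  by apply/funext => x; have [_ ->] := D x.
split; first (split=> [x|h]).
- by have [] := D x.
- rewrite E1; apply: continuous_big => [|i _]; first exact: add_continuous.
  by move=> x; exact: (continuousM (@cst_continuous _ _ (h 0 i) x) ((df i).2.1 x)).
- exact: bounded_funE.
- move=> h _; rewrite E1; apply: bounded_sum => i.
  have [M HM] := bounded_funE (bdf i).1.
  by exists (`|h 0 i| * M) => x; rewrite normrM ler_wpM2l.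
Qed.

Lemma partial_d f i x : differentiable f x -> partial i f x = 'd f x (delta_mx 0 i).
Proof. by move=> df; rewrite /partial deriveE. Qed.

Lemma Ck2_bC2 f : Ck 2 f -> bounded_Ck_norm 2 f -> bC2 f.
Proof.
move=> [cf df] [bf bdf].
have b1 : bC1 setT f.
  apply: Ck1_bC1; split=> // i.
  - by have [H1 [H2 _]] := df i.
  - by have [H1 _] := bdf i.
split=> // h.
apply: (@eq_bC1 _ _ _ (fun x => \sum_i h 0 i * partial i f x)) => [x|].
  have [[D _] _ _] := b1.
  rewrite {2}(row_sum_delta h) linear_sum; apply: eq_bigr => i _.
  by rewrite linearZ partial_d.
apply: bC1_sum => i; apply: (bC1M (bC1_cst _ (h 0 i))).
by apply: Ck1_bC1; [exact: (df i).2|exact: bdf].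
Qed.

End InitialRegularity.

(** * Initial momentum *)

Section InitialData.
Context {R : realType} {n : nat} (c : R).
Hypothesis c0 : 0 < c.
Local Notation V := 'rV[R]_n.

Section FixedVelocity.
Variable f : 'I_n -> V -> R.
Hypothesis f2 : forall i, bC2 (f i).

(** In units of the speed of light: [speed2] is [|f|^2 / c^2] for the initial
velocity [f], and [momentum2] is the squared norm of the momentum divided by
[c^2], since [1 / (1 - z) - 1 = z / (1 - z)] for [z = speed2]. *)
Definition speed2 (x : V) : R := (\sum_i f i x ^+ 2) / c ^+ 2.
Definition lorentz (x : V) : R := isqrt1 (- speed2 x).
Definition momentum i (x : V) : R := f i x * lorentz x.
Definition momentum2 (x : V) : R := lorentz x ^+ 2 - 1.

Let df i x : differentiable (f i) x.
Proof. by have [[[]]] := f2 i. Qed.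

Lemma bC2_speed2 : bC2 speed2.
Proof.
apply: (@eq_bC2 _ _ ((fun x => \sum_i f i x * f i x) \* cst (c ^- 2))) => [x|].
  by rewrite /speed2 /=; congr (_ * _); apply: eq_bigr => i _; rewrite expr2.
by apply: bC2M; [apply: bC2_sum => i; exact: bC2M|exact: bC2_cst].
Qed.

Let ds x : differentiable speed2 x.
Proof. by have [[[]]] := bC2_speed2. Qed.

Lemma d_speed2 x h : 'd speed2 x h = 2 / c ^+ 2 * \sum_i f i x * 'd (f i) x h.
Proof.
have D : is_diff x (\sum_i (f i * f i))
    (\sum_i (fun h => f i x * 'd (f i) x h + f i x * 'd (f i) x h)).
  apply: is_diff_sum => i.
  exact: is_diffM (differentiableP (df i x)) (differentiableP (df i x)).
have -> : speed2 = c ^- 2 *: (\sum_i (f i * f i)).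
  apply/funext => y; rewrite /speed2 mulrC -[RHS]/(_ * _) fct_sumE.
  by congr (_ * _); apply: eq_bigr => i _; rewrite expr2.
have [_ ->] := is_diffZ (c ^- 2) D.
rewrite -[LHS]/(_ * _) fct_sumE mulr_sumr mulr_sumr; apply: eq_bigr => i _.
by ring.
Qed.

Hypothesis s_le : forall x, speed2 x <= 2^-1.

Let s_ge x : -2^-1 <= - speed2 x. Proof. by rewrite lerN2. Qed.

Let s_ge0 x : 0 <= speed2 x.
Proof. by rewrite divr_ge0 ?sqr_ge0// sumr_ge0// => i _; exact: sqr_ge0. Qed.

Let s_gtN1 x : -1 < - speed2 x. Proof. have := s_le x; lra. Qed.

Let lorentzE : lorentz =1 isqrt1_iter 0 \o (fun x => - speed2 x).
Proof. by move=> x; rewrite /lorentz /isqrt1_iter/= mul1r expr1. Qed.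

Let bC2_Nspeed2 : bC2 (fun x => - speed2 x).
Proof.
apply: (@eq_bC2 _ _ (cst (-1) \* speed2)); first by move=> x; rewrite /= mulN1r.
by apply: bC2M; [exact: bC2_cst|exact: bC2_speed2].
Qed.

Lemma bC2_lorentz : bC2 lorentz.
Proof.
apply: (@eq_bC2 _ _ (isqrt1_iter 0 \o (fun x => - speed2 x))).
  by move=> x; rewrite lorentzE.
exact: bC2_isqrt1_iter.
Qed.

Let dl x : differentiable lorentz x.
Proof. by have [[[]]] := bC2_lorentz. Qed.

Lemma d_lorentz x h : 'd lorentz x h = - isqrt1_iter 1 (- speed2 x) * 'd speed2 x h.
Proof.
rewrite (funext lorentzE) d_isqrt1_iter//; last by have [[[]]] := bC2_Nspeed2.
by have [_ ->] := is_diffN (differentiableP (ds x)); rewrite fctE mulrN mulNr.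
Qed.

Lemma bC2_momentum i : bC2 (momentum i).
Proof. exact: bC2M (f2 i) bC2_lorentz. Qed.

Lemma d_momentum i x h :
  'd (momentum i) x h = f i x * 'd lorentz x h + lorentz x * 'd (f i) x h.
Proof. exact: d_mul. Qed.

Lemma bC2_momentum2 : bC2 momentum2.
Proof.
apply: (@eq_bC2 _ _ ((lorentz \* lorentz) \+ cst (-1))).
  by move=> x; rewrite /= -expr2.
by apply: bC2D; [exact: bC2M bC2_lorentz bC2_lorentz|exact: bC2_cst].
Qed.

Lemma d_momentum2 x h : 'd momentum2 x h = 2 * lorentz x * 'd lorentz x h.
Proof.
have -> : momentum2 = (lorentz \* lorentz) \+ cst (-1).
  by apply/funext => y; rewrite /= -expr2.
rewrite d_add ?d_mul//; last exact: differentiableM.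
by rewrite diff_cst addr0; ring.
Qed.

Lemma lorentz_gt0 x : 0 < lorentz x. Proof. exact: isqrt1_gt0. Qed.

Lemma lorentz_sqr x : lorentz x ^+ 2 = (1 - speed2 x)^-1.
Proof. by rewrite isqrt1_sqr. Qed.

Lemma momentum2_ge0 x : 0 <= momentum2 x.
Proof.
rewrite /momentum2 lorentz_sqr subr_ge0 invf_ge1; have := s_ge0 x; have := s_le x; lra.
Qed.

Lemma sum_momentum_sqr x : \sum_i momentum i x ^+ 2 = c ^+ 2 * momentum2 x.
Proof.
have s1 : 1 - speed2 x != 0 by rewrite gt_eqF//; have := s_gtN1 x; lra.
have -> : \sum_i momentum i x ^+ 2 = (c ^+ 2 * speed2 x) * lorentz x ^+ 2.
  have -> : c ^+ 2 * speed2 x = \sum_i f i x ^+ 2.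
    by rewrite /speed2; field; rewrite gt_eqF.
  rewrite mulr_suml.
  by apply: eq_bigr => i _; rewrite exprMn.
by rewrite /momentum2 lorentz_sqr; field.
Qed.

(** This inverts the change of variable from velocity to momentum, and shows that
the velocity rebuilt from the momentum takes its prescribed value at [t = 0]. *)
Lemma isqrt1_momentum2 x : lorentz x * isqrt1 (momentum2 x) = 1.
Proof.
rewrite /isqrt1 /momentum2 addrC subrK sqrtr_sqr gtr0_norm ?lorentz_gt0//.
by rewrite divff// gt_eqF// lorentz_gt0.
Qed.

(** All bounds are explicit in [N], which will be [eps] times a bound on the data:
the smallness of [eps] has to be chosen before the functions built from it. *)
Section Bounds.
Variables (N tau : R) (j : 'I_n).
Hypotheses (fN : forall i x, `|f i x| <= N)
  (dfN : forall i x, `|'d (f i) x (delta_mx 0 j)| <= N)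
  (tauE : tau = 2 * n%:R * N ^+ 2 / c ^+ 2) (tau1 : 16 * tau <= 1).
Local Notation ej := (delta_mx 0 j : V).

Let N0 : 0 <= N. Proof. by apply: le_trans (fN j 0). Qed.

Let ds_le x : `|'d speed2 x ej| <= tau.
Proof.
rewrite d_speed2 normrM ger0_norm; last by rewrite divr_ge0// sqr_ge0.
have -> : tau = 2 / c ^+ 2 * (n%:R * N ^+ 2).
  by rewrite tauE; field; rewrite gt_eqF.
rewrite ler_wpM2l ?divr_ge0 ?sqr_ge0//.
rewrite (le_trans (ler_norm_sum _ _ _))//.
rewrite (@le_trans _ _ (\sum_(i < n) N ^+ 2))//; last first.
  by rewrite sumr_const card_ord mulr_natl.
by apply: ler_sum => i _; rewrite normrM expr2 ler_pM.
Qed.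

Let lorentz_le2 x : `|lorentz x| <= 2.
Proof. by rewrite gtr0_norm ?lorentz_gt0// isqrt1_le2. Qed.

Let dl_le x : `|'d lorentz x ej| <= 4 * tau.
Proof.
rewrite d_lorentz normrM normrN ler_pM ?ds_le//.
rewrite (le_trans (isqrt1_iter_le2 _ (s_ge _)))//=.
by rewrite mulr1 normrN ger0_norm//; lra.
Qed.

Lemma momentum_le i x : `|momentum i x| <= 6 * N.
Proof.
have N0' : 0 <= N := le_trans (normr_ge0 _) (fN i x).
rewrite normrM mulrC (@le_trans _ _ (2 * N))//; first by rewrite ler_pM.
by rewrite ler_wpM2r//; lra.
Qed.

Lemma d_momentum_le i x : `|'d (momentum i) x ej| <= 6 * N.
Proof.
rewrite d_momentum; apply: le_trans (ler_normD _ _) _; rewrite !normrM.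
have h1 : `|f i x| * `|'d lorentz x ej| <= N * 4.
  have t1 : 16 * tau <= 1 :> R by exact: tau1.
  have t2 : 4 * tau <= 4 :> R by lra.
  by apply: ler_pM => //; exact: le_trans (dl_le x) t2.
have h2 : `|lorentz x| * `|'d (f i) x ej| <= 2 * N by rewrite ler_pM.
apply: le_trans (lerD h1 h2) _; lra.
Qed.

Lemma d_momentum2_le x : `|'d momentum2 x ej| <= 1.
Proof.
rewrite d_momentum2 normrM normrM ger0_norm//.
have h : 2 * `|lorentz x| * `|'d lorentz x ej| <= 2 * 2 * (4 * tau).
  by rewrite ler_pM// ?mulr_ge0// ler_pM.
have t1 : 16 * tau <= 1 :> R by exact: tau1.
have t2 : 2 * 2 * (4 * tau) <= 1 :> R by lra.
exact: le_trans h t2.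
Qed.

End Bounds.
End FixedVelocity.

Lemma small_momentum (f : 'I_n -> V -> R) (W : R) : (1 <= n)%N -> 0 < W ->
  (forall i, bC2 (f i)) ->
  exists eps0 : R, 0 < eps0 /\ forall eps, 0 <= eps <= eps0 ->
    let g := fun i x => eps * f i x in
    [/\ forall i, bC2 (g i), forall x, speed2 g x <= 2^-1,
        forall i x, `|momentum g i x| <= W,
        forall i j x, `|'d (momentum g i) x (delta_mx 0 j)| <= W
      & forall j x, `|'d (momentum2 g) x (delta_mx 0 j)| <= 1].
Proof.
move=> n1 W0 f2.
have [N [N1 [fN dfN]]] : exists N : R, 1 <= N /\
    (forall i x, `|f i x| <= N) /\ forall i j x, `|'d (f i) x (delta_mx 0 j)| <= N.
  have /choice[M1 HM1] i : exists M, forall x, `|f i x| <= M.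
    by have [[_ b _] _] := f2 i.
  have /choice[M2 HM2] (ij : 'I_n * 'I_n) : exists M, forall x,
      `|'d (f ij.1) x (delta_mx 0 ij.2)| <= M.
    by have [[_ _ b] _] := f2 ij.1; exact: b.
  exists (1 + (\sum_i `|M1 i| + \sum_ij `|M2 ij|)).
  have s1 : 0 <= \sum_i `|M1 i| by rewrite sumr_ge0.
  have s2 : 0 <= \sum_ij `|M2 ij| by rewrite sumr_ge0.
  split; first by rewrite lerDl addr_ge0.
  split=> [i x|i j x].
    rewrite (le_trans (HM1 i x))// (le_trans (ler_norm _))//.
    have : `|M1 i| <= \sum_i `|M1 i| by rewrite (bigD1 i)//= lerDl sumr_ge0.
    by move=> h; lra.
  rewrite (le_trans (HM2 (i, j) x))// (le_trans (ler_norm _))//.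
  have : `|M2 (i, j)| <= \sum_ij `|M2 ij|.
    by rewrite (bigD1 (i, j))//= lerDl sumr_ge0.
  by move=> h; lra.
have N0 : 0 < N by lra.
have n0 : 0 < n%:R :> R by rewrite ltr0n.
have n1' : 1 <= n%:R :> R by rewrite ler1n.
have A0 : 0 < 6 * N by rewrite mulr_gt0.
have B0 : 0 < 6 * n%:R * N by rewrite !mulr_gt0.
(* The first bound makes [6 eps N <= W]; the second one makes [16 tau <= 1], with
   [tau = 2 n (eps N) ^ 2 / c ^ 2]. *)
exists (Num.min (W / (6 * N)) (c / (6 * n%:R * N))).
split; first by rewrite lt_min !divr_gt0.
move=> eps /andP[e0 e1] g.
have [eW ec] : eps * (6 * N) <= W /\ eps * (6 * n%:R * N) <= c.
  by move: e1; rewrite le_min !ler_pdivlMr// => /andP[].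
pose N' := eps * N; pose tau := 2 * n%:R * N' ^+ 2 / c ^+ 2.
have N'0 : 0 <= N' by rewrite mulr_ge0// ltW.
have g2 i : bC2 (g i) by exact: bC2Z.
have gN i x : `|g i x| <= N'.
  by rewrite /g normrM (ger0_norm e0) ler_wpM2l.
have dgN i j x : `|'d (g i) x (delta_mx 0 j)| <= N'.
  have [[[Df _] _ _] _] := f2 i.
  by rewrite (d_scale eps (delta_mx 0 j) (Df x)) normrM (ger0_norm e0) ler_wpM2l.
have tau1 : 16 * tau <= 1.
  rewrite /tau mulrA ler_pdivrMr ?exprn_gt0// mul1r.
  have h1 : 6 * n%:R * N' <= c by rewrite /N'; lra.
  have h2 : (6 * n%:R * N') ^+ 2 <= c ^+ 2.
    by rewrite lerXn2r ?nnegrE ?(ltW c0)// !mulr_ge0// ltW.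
  apply: le_trans h2.
  have -> : 16 * (2 * n%:R * N' ^+ 2) = (32 * n%:R) * N' ^+ 2 by ring.
  have -> : (6 * n%:R * N') ^+ 2 = (36 * n%:R * n%:R) * N' ^+ 2 by ring.
  rewrite ler_wpM2r ?sqr_ge0//.
  have : 36 * n%:R * 1 <= 36 * n%:R * n%:R :> R by rewrite ler_wpM2l// mulr_ge0// ltW.
  lra.
have s_le x : speed2 g x <= 2^-1.
  rewrite /speed2 (@le_trans _ _ tau)//; last by lra.
  rewrite /tau ler_wpM2r ?invr_ge0 ?sqr_ge0//.
  rewrite (@le_trans _ _ (\sum_(i < n) N' ^+ 2))//.
    apply: ler_sum => i _; rewrite -(real_normK (num_real (g i x))).
    by rewrite lerXn2r ?nnegrE.
  rewrite sumr_const card_ord -[leLHS]mulr_natl ler_wpM2r ?sqr_ge0//; lra.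
have NW : 6 * N' <= W by rewrite /N'; lra.
split=> //.
- move=> i x.
  exact: le_trans (momentum_le s_le gN i x) NW.
- move=> i j x.
  exact: le_trans (d_momentum_le g2 s_le gN (fun i => dgN i j) erefl tau1 i x) NW.
- move=> j x.
  exact: (d_momentum2_le g2 s_le gN (fun i => dgN i j) erefl tau1 x).
Qed.

End InitialData.

(** * The flow in Lagrangian coordinates *)

Section DirectionalRules.
Context {R : realType} {E : normedModType R}.
Implicit Types (f g : E -> R).

(** Sums and products of values of ['d] are slow to rewrite; this relation carries
the derivative in one direction as a separate real number. *)
Definition has_d f p h (v : R) : Prop := differentiable f p /\ 'd f p h = v.

Lemma has_d_eq f p h v v' : has_d f p h v -> v = v' -> has_d f p h v'.
Proof. by move=> + <-. Qed.

Lemma has_d_is_diff f df p h : is_diff p f df -> has_d f p h (df h).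
Proof.
move=> D; split; first by case: D.
exact: (congr1 (fun u => u h) (diff_val (is_diff_def := D))).
Qed.

Lemma has_d_cst (k : R) p h : has_d (cst k) p h 0.
Proof. by split; [exact: differentiable_cst|rewrite diff_cst]. Qed.

Lemma has_dD f g p h u v : has_d f p h u -> has_d g p h v ->
  has_d (f \+ g) p h (u + v).
Proof.
by move=> [Df <-] [Dg <-]; split; [exact: differentiableD|exact: d_add].
Qed.

Lemma has_dM f g p h u v : has_d f p h u -> has_d g p h v ->
  has_d (f \* g) p h (f p * v + g p * u).
Proof.
by move=> [Df <-] [Dg <-]; split; [exact: differentiableM|exact: d_mul].
Qed.

Lemma has_d_sum (I : Type) (r : seq I) (f : I -> E -> R) p h (u : I -> R) :
  (forall i, has_d (f i) p h (u i)) ->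
  has_d (fun q => \sum_(i <- r) f i q) p h (\sum_(i <- r) u i).
Proof.
move=> fu; elim: r => [|i r IH].
  rewrite big_nil (_ : (fun _ => _) = cst 0); first exact: has_d_cst.
  by apply/funext => q; rewrite big_nil.
rewrite big_cons (_ : (fun _ => _) = f i \+ (fun q => \sum_(i <- r) f i q)).
  exact: has_dD.
by apply/funext => q; rewrite big_cons.
Qed.

Lemma has_d_comp1 (phi : R -> R) f p h d u : is_derive (f p) 1 phi d ->
  has_d f p h u -> has_d (phi \o f) p h (d * u).
Proof.
move=> Dphi [Df <-]; have [D1 D2] := @d_comp1 _ _ phi (cst d) f p h Df Dphi.
by split.
Qed.

End DirectionalRules.

Section Lagrangian.
Context {R : realType} {n : nat}.
Local Notation V := 'rV[R]_n.
Local Notation E := (R * 'rV[R]_n)%type.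

Definition spatial : set E := [set h | h.1 = 0].

Lemma is_diff_time (f f' : R -> R) (p : E) : is_derive (p.1) 1 f (f' p.1) ->
  is_diff p (fun q : E => f q.1) (fun h : E => h.1 * f' p.1).
Proof.
move=> [d1 d2].
have df : is_diff (p.1) f (fun h : R => h * f' p.1).
  apply: DiffDef; first exact/derivable1_diffP.
  rewrite diff1E; last exact/derivable1_diffP.
  by apply/funext => h; rewrite derive1E d2.
exact: (is_diff_comp (is_diff_fst p) df).
Qed.

Lemma bC1_time (f f' : R -> R) : (forall t : R, is_derive t 1 f (f' t)) ->
  continuous f' -> (exists N, forall t, `|f t| <= N) ->
  bC1 spatial (fun q : E => f q.1).
Proof.
move=> df cf' [N HN].
have D p := is_diff_time (df (p.1 : R)).
have E1 (p h : E) : 'd (fun q : E => f q.1) p h = h.1 * f' p.1.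
  exact: (congr1 (fun u => u h) (diff_val (is_diff_def := D p))).
split; first split=> [p|h].
- by have [] := D p.
- have -> : (fun p => 'd (fun q : E => f q.1) p h) = (fun p : E => h.1 * f' p.1).
    by apply/funext => p; exact: E1.
  move=> p; have c1 := continuous_comp (@fst_continuous _ _ p) (cf' p.1).
  exact: (continuousM (@cst_continuous _ _ h.1 p) c1).
- by exists N => p; exact: HN.
- by move=> h h0; exists 0 => p; rewrite E1 h0 mul0r normr0.
Qed.

Lemma bC1_space (f : V -> R) : bC1 setT f -> bC1 spatial (fun q : E => f q.2).
Proof.
move=> [Cf [N HN] bdf]; split; first exact: C1_space.
- by exists N => p; exact: HN.
- move=> h _; have [N' HN'] := bdf h.2 Logic.I; exists N' => p.
  rewrite (congr1 (fun u => u h) (diff_val (is_diff_def := is_diff_space (Cf.1 (p.2))))).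
  exact: HN'.
Qed.

Variables (alpha dalpha b I : R -> R) (M : R) (Q : nat -> R -> R -> R).
Hypotheses (dalphaP : forall t : R, is_derive t 1 alpha (dalpha t))
  (cdalpha : continuous dalpha)
  (alpha_bounded : exists N, forall t, `|alpha t| <= N)
  (cb : continuous b) (b01 : forall s, 0 <= b s <= 1)
  (HQ : flow_integral b Q)
  (I0 : I 0 = 0) (dI : forall t : R, is_derive t 1 I (b t ^+ 2))
  (IM : forall t, `|I t| <= M).

Variables (w : 'I_n -> V -> R) (k : V -> R).
Hypotheses (w2 : forall i, bC2 (w i)) (k2 : bC2 k) (k0 : forall x, 0 <= k x).

Let C1k : C1 k. Proof. by have [[]] := k2. Qed.
Let dw i x : differentiable (w i) x. Proof. by have [[[]]] := w2 i. Qed.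
Let dk x : differentiable k x. Proof. by have [[[]]] := k2. Qed.

(** The characteristic issued from [y] is at [y + displacement (t, y)] at time [t]. *)
Definition displacement_coord i (p : E) : R := w i p.2 * flow_along Q k 0 p.
Definition displacement (p : E) : V := \row_i displacement_coord i p.

(** The formal derivative of [displacement_coord i] in the direction [j]. It is a
bounded C^1 function because the initial velocity is C^2. *)
Definition displacement_dx i j (p : E) : R :=
  'd (w i) (p.2 : V) (delta_mx 0 j) * flow_along Q k 0 p
  + w i p.2 * (flow_along Q k 1 p * 'd k (p.2 : V) (delta_mx 0 j)).

Definition deformation i j (p : E) : R := (i == j)%:R + displacement_dx i j p.
Definition jacobian_det (p : E) : R := \det (\matrix_(i, j) deformation i j p).

(** The velocity on a characteristic is [w / sqrt (a^2 + k)], that is [w * alpha]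
with [alpha = 1 / a], times this factor. *)
Definition damping (p : E) : R := isqrt1_iter 0 (k p.2 * alpha p.1 ^+ 2).
Definition lag_velocity i (p : E) : R := w i p.2 * (alpha p.1 * damping p).

Let bC1_flow j : bC1 spatial (flow_along Q k j).
Proof. exact: (bC1_flow_along cb b01 HQ I0 dI IM k0 C1k j k2.1). Qed.

Let dflow j p : is_diff p (flow_along Q k j)
  (fun h : E => h.1 * flow_rate b j (k p.2) p.1
           + flow_along Q k j.+1 p * 'd k (p.2 : V) h.2).
Proof. exact: (is_diff_flow_along b01 HQ I0 dI IM k0 C1k j p). Qed.

Lemma bC1_displacement_coord i : bC1 spatial (displacement_coord i).
Proof. exact: bC1M (bC1_space (w2 i).1) (bC1_flow 0). Qed.

Lemma d_displacement_coord i (p h : E) : 'd (displacement_coord i) p h =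
  w i p.2 * (h.1 * flow_rate b 0 (k p.2) p.1
             + flow_along Q k 1 p * 'd k (p.2 : V) h.2)
  + flow_along Q k 0 p * 'd (w i) (p.2 : V) h.2.
Proof.
have D := is_diffM (is_diff_space (dw i (p.2))) (dflow 0 p).
exact: (congr1 (fun u => u h) (diff_val (is_diff_def := D))).
Qed.

Lemma C1_displacement : C1 displacement.
Proof.
apply: C1_row => i; have -> : (fun y => displacement y 0 i) = displacement_coord i.
  by apply/funext => y; rewrite mxE.
by have [] := bC1_displacement_coord i.
Qed.

Lemma d_displacement (p h : E) i :
  'd displacement p h 0 i = 'd (displacement_coord i) p h.
Proof.
have D := is_diff_coord i (C1_displacement.1 p).
have {}D := congr1 (fun u => u h) (diff_val (is_diff_def := D)).
rewrite -[LHS]D; congr ('d _ p h).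
by apply/funext => y; rewrite mxE.
Qed.

Lemma d_displacement_dx i j (p : E) :
  'd displacement p (edx j) 0 i = displacement_dx i j p.
Proof.
rewrite d_displacement d_displacement_coord mul0r add0r addrC mulrC.
by congr (_ * _ + _).
Qed.

Lemma d_displacement_dt i (p : E) :
  'd displacement p edt 0 i = w i p.2 * flow_rate b 0 (k p.2) p.1.
Proof.
rewrite d_displacement d_displacement_coord mul1r !linear0.
by rewrite !mulr0 !addr0.
Qed.

Lemma displacement0 x : displacement (0, x) = 0.
Proof.
apply/rowP => i; rewrite !mxE /displacement_coord /flow_along /=.
by have [-> _] := HQ 0 (k0 x); rewrite mulr0.
Qed.

Lemma jacobian_det0 x : jacobian_det (0, x) = 1.
Proof.
rewrite /jacobian_det -(det1 R n); congr (\det _); apply/matrixP => i j.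
rewrite !mxE /deformation /displacement_dx /flow_along /=.
have [-> _] := HQ 0 (k0 x); have [-> _] := HQ 1 (k0 x).
by rewrite mul0r !mulr0 !addr0.
Qed.

Lemma bC1_deformation i j : bC1 spatial (deformation i j).
Proof.
apply: (bC1D (bC1_cst _ (i == j)%:R)); apply: bC1D; apply: bC1M.
- exact: bC1_space ((w2 i).2 _).
- exact: bC1_flow.
- exact: bC1_space (w2 i).1.
- by apply: bC1M; [exact: bC1_flow|exact: bC1_space (k2.2 _)].
Qed.

Lemma deformation_dt i j (p : E) : 'd (deformation i j) p edt =
  'd (w i) (p.2 : V) (delta_mx 0 j) * flow_rate b 0 (k p.2) p.1
  + w i p.2 * (flow_rate b 1 (k p.2) p.1 * 'd k (p.2 : V) (delta_mx 0 j)).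
Proof.
pose A (q : E) := 'd (w i) (q.2 : V) (delta_mx 0 j).
pose K (q : E) := 'd k (q.2 : V) (delta_mx 0 j).
pose W (q : E) := w i q.2.
have hA : has_d A p edt 0.
  have [[DA _] _ _] : bC1 setT (fun x => 'd (w i) x (delta_mx 0 j)).
    exact: (w2 i).2.
  apply: has_d_eq (has_d_is_diff edt (is_diff_space (DA (p.2)))) _.
  exact: linear0.
have hK : has_d K p edt 0.
  have [[DK _] _ _] : bC1 setT (fun x => 'd k x (delta_mx 0 j)).
    exact: k2.2.
  apply: has_d_eq (has_d_is_diff edt (is_diff_space (DK (p.2)))) _.
  exact: linear0.
have hW : has_d W p edt 0.
  apply: has_d_eq (has_d_is_diff edt (is_diff_space (dw i (p.2)))) _.
  exact: linear0.
have hF m : has_d (flow_along Q k m) p edt (flow_rate b m (k p.2) p.1).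
  apply: has_d_eq (has_d_is_diff edt (dflow m p)) _.
  by rewrite mul1r linear0 mulr0 addr0.
have [_ D] := has_dD (has_d_cst (i == j)%:R p edt)
  (has_dD (has_dM hA (hF 0)) (has_dM hW (has_dM (hF 1) hK))).
apply: etrans D _.
by rewrite !mulr0 !addr0 !add0r; congr (_ + _ * _); exact: mulrC.
Qed.

Let a_ (q : E) : R := alpha q.1.
Let k_ (q : E) : R := k q.2.
Let z_ : E -> R := k_ \* (a_ \* a_).

Let bC1a : bC1 spatial a_. Proof. exact: bC1_time dalphaP cdalpha alpha_bounded. Qed.
Let bC1k : bC1 spatial k_. Proof. exact: bC1_space k2.1. Qed.
Let bC1z : bC1 spatial z_. Proof. exact: bC1M bC1k (bC1M bC1a bC1a). Qed.

Let z_ge p : -2^-1 <= z_ p.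
Proof.
apply: (@le_trans _ _ 0); first by rewrite oppr_le0 invr_ge0.
apply: mulr_ge0; [exact: k0|exact: sqr_ge0].
Qed.

Let dampingE : damping = isqrt1_iter 0 \o z_.
Proof.
apply/funext => q; congr (isqrt1_iter 0 (_ * _)); exact: expr2.
Qed.

Lemma bC1_damping : bC1 spatial damping.
Proof. by rewrite dampingE; exact: bC1_isqrt1_iter z_ge bC1z. Qed.

Lemma bC1_lag_velocity i : bC1 spatial (lag_velocity i).
Proof. exact: bC1M (bC1_space (w2 i).1) (bC1M bC1a bC1_damping). Qed.

Let ha (p h : E) : has_d a_ p h (h.1 * dalpha p.1).
Proof. exact: has_d_is_diff (is_diff_time (dalphaP p.1)). Qed.

Let hk (p h : E) : has_d k_ p h ('d k (p.2 : V) h.2).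
Proof. exact: has_d_is_diff (is_diff_space (dk (p.2))). Qed.

Let half_gtN1 : -1 < -2^-1 :> R. Proof. by lra. Qed.

Let square_rule (x y z u v : R) :
  z * (x * (u * y) + x * (u * y)) + (x * x) * v =
  z * (2 * x * (u * y)) + x ^+ 2 * v.
Proof. by ring. Qed.

Let hz (p h : E) : has_d z_ p h (k p.2 * (2 * alpha p.1 * (h.1 * dalpha p.1))
    + alpha p.1 ^+ 2 * 'd k (p.2 : V) h.2).
Proof.
exact: has_d_eq (has_dM (hk p h) (has_dM (ha p h) (ha p h))) (square_rule _ _ _ _ _).
Qed.

Lemma has_d_damping (p h : E) : has_d damping p h
  (isqrt1_iter 1 (k p.2 * alpha p.1 ^+ 2) *
  (k p.2 * (2 * alpha p.1 * (h.1 * dalpha p.1)) + alpha p.1 ^+ 2 * 'd k (p.2 : V) h.2)).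
Proof.
have z1 : -1 < z_ p := lt_le_trans half_gtN1 (z_ge p).
have D2 := has_d_comp1 (is_derive_isqrt1_iter 0 z1) (hz p h).
have zE : k p.2 * alpha p.1 ^+ 2 = z_ p by congr (_ * _); exact: expr2.
rewrite dampingE zE; exact: D2.
Qed.

Lemma has_d_lag_velocity i (p h : E) (u : R) : has_d damping p h u ->
  has_d (lag_velocity i) p h
  (w i p.2 * (alpha p.1 * u + damping p * (h.1 * dalpha p.1))
  + alpha p.1 * damping p * 'd (w i) (p.2 : V) h.2).
Proof.
move=> hu; have hw := has_d_is_diff h (is_diff_space (dw i (p.2))).
exact: has_dM hw (has_dM (ha p h) hu).
Qed.

Hypothesis b_alpha : forall t, 0 <= t -> b t = alpha t.

Lemma displacement_velocity i (p : E) : 0 <= p.1 ->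
  'd displacement p edt 0 i = lag_velocity i p * alpha p.1.
Proof.
move=> p0; rewrite d_displacement_dt /flow_rate b_alpha// /lag_velocity /damping.
set s := isqrt1_iter 0 _.
rewrite -[LHS]/(w i p.2 * (alpha p.1 ^+ 2 * s)).
by move: (w i p.2) (alpha p.1) s => x y z; ring.
Qed.

Let mixed_rule (al s s1 K da dki dwi W : R) :
  dwi * (al ^+ 2 * s) + W * ((al ^+ 4 * s1) * dki) =
  al * (W * (al * (s1 * (K * (2 * al * (0 * da)) + al ^+ 2 * dki))
    + s * (0 * da)) + al * s * dwi).
Proof. by ring. Qed.

(** Equality of mixed derivatives of the characteristics, in time and label,
checked on the explicit formulas. *)
Lemma deformation_velocity i j (p : E) : 0 <= p.1 ->
  'd (deformation i j) p edt = alpha p.1 * 'd (lag_velocity i) p (edx j).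
Proof.
move=> p0; have [_ ->] := has_d_lag_velocity i (has_d_damping p (edx j)).
rewrite deformation_dt /flow_rate (b_alpha p0).
exact: mixed_rule.
Qed.

Lemma damping_sqr (p : E) : damping p ^+ 2 * (1 + k p.2 * alpha p.1 ^+ 2) = 1.
Proof.
have z0 : 0 <= k p.2 * alpha p.1 ^+ 2 by rewrite mulr_ge0 ?sqr_ge0.
rewrite /damping /isqrt1_iter mul1r expr1 isqrt1_sqr ?mulVf//; last by lra.
by rewrite gt_eqF//; lra.
Qed.

Lemma damping_gt0 (p : E) : 0 < damping p.
Proof.
have z0 : 0 <= k p.2 * alpha p.1 ^+ 2 by rewrite mulr_ge0 ?sqr_ge0.
by rewrite /damping /isqrt1_iter mul1r expr1 isqrt1_gt0//; lra.
Qed.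

Lemma has_d_damping_dt (p : E) : has_d damping p edt
  (- damping p ^+ 3 * k p.2 * alpha p.1 * dalpha p.1).
Proof.
apply: has_d_eq (has_d_damping p edt) _.
rewrite linear0 mulr0 addr0 mul1r /damping /isqrt1_iter /=.
by rewrite mul1r expr1 mulr1; field.
Qed.

(** This is the momentum equation along a characteristic: with [alpha = 1 / a] and
[s] the damping, it reads [dv/dt = - (a'/a) v s^2], and
[s^2 = 1 - |v|^2 / c^2] is the relativistic correction. *)
Lemma has_d_lag_velocity_dt i (p : E) : has_d (lag_velocity i) p edt
  (w i p.2 * dalpha p.1 * damping p ^+ 3).
Proof.
apply: has_d_eq (has_d_lag_velocity i (has_d_damping_dt p)) _.
rewrite linear0 mulr0 addr0 mul1r.
have := damping_sqr p.
set s := damping p; set K := k _; set al := alpha _; set da := dalpha _.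
move=> s1; have E1 : s ^+ 3 = s - s ^+ 3 * K * al ^+ 2.
  by rewrite -{2}[s]mulr1 -s1; ring.
by rewrite [in RHS]E1; ring.
Qed.

End Lagrangian.

(** * From labels to positions *)

Section Eulerian.
Context {R : realType} {n : nat}.
Local Notation V := 'rV[R]_n.
Local Notation E := (R * 'rV[R]_n)%type.

Variables (F B : E -> V).
Hypotheses (CF : C1 F) (CB : C1 B)
  (BE : forall p, B p + F (with_time B p) = p.2)
  (BX : forall t x, B (t, x + F (t, x)) = x)
  (dB : forall p (h : V), `|'d B p ((0, h) : E)| <= 2 * `|h|).

Let X (q : E) : V := q.2 + F q.

Let dX q : is_diff q X (fun h : E => h.2 + 'd F q h).
Proof. exact: is_diffD (is_diff_snd q) (differentiableP (CF.1 q)). Qed.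

(** A function [f] of time and label is its Eulerian version [f \o with_time B]
composed with the flow, so its derivatives follow from the chain rule without
any formula for the derivatives of [B]. *)
Lemma eulerian_chain (f : E -> R) (p h : E) : C1 f ->
  'd f (with_time B p) h =
  'd (f \o with_time B) p ((h.1, h.2 + 'd F (with_time B p) h) : E).
Proof.
move=> Cf; have Cg := C1_comp_with_time Cf CB.
have fE : f = (f \o with_time B) \o with_time X.
  by apply/funext => -[t x]; rewrite /= /with_time /X /= BX.
have XE : with_time X (with_time B p) = p.
  by rewrite /with_time /X /= BE; case: (p).
have [dX1 dX2] := dX (with_time B p).
have gX : differentiable (f \o with_time B) (with_time X (with_time B p)).
  exact: Cg.1.
have [_ D] := has_d_is_diff h (is_diff_comp_with_time gX dX1).
rewrite {1}fE; apply: etrans D _; rewrite XE.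
congr ('d _ p _); congr (_, _).
exact: (congr1 (fun u => u h) dX2).
Qed.

(** The time derivative at a fixed label is the derivative along the flow. *)
Lemma material_derivative (f : E -> R) (p : E) : C1 f ->
  'd f (with_time B p) edt = 'd (f \o with_time B) p edt
   + \sum_j 'd F (with_time B p) edt 0 j * 'd (f \o with_time B) p (edx j).
Proof.
move=> Cf; apply: etrans (eulerian_chain p edt Cf) _.
apply: etrans (d_basis _ p _) _; congr (_ + _); first exact: scale1r.
apply: eq_bigr => j _; congr (_ * _).
exact: (congr1 (fun u : V => u 0 j) (add0r ('d F (with_time B p) edt))).
Qed.

Definition label_jacobian (P : E) : 'M[R]_n :=
  \matrix_(i, j) ((i == j)%:R + 'd F P (edx j) 0 i).

Lemma eulerian_gradient (f : E -> R) (p : E) j : C1 f ->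
  'd f (with_time B p) (edx j) =
   \sum_l label_jacobian (with_time B p) l j * 'd (f \o with_time B) p (edx l).
Proof.
move=> Cf; apply: etrans (eulerian_chain p (edx j) Cf) _.
apply: etrans (d_basis _ p _) _; rewrite [X in X + _]scale0r add0r.
apply: eq_bigr => l _; congr (_ * _); rewrite [RHS]mxE.
by apply: etrans (mxE _ _ _ _) _; rewrite mxE eqxx.
Qed.

(** Spatial bounds survive the passage to Eulerian coordinates because the inverse
flow is 2-Lipschitz in space. *)
Lemma bC1_eulerian (f : E -> R) : bC1 spatial f -> bC1 spatial (f \o with_time B).
Proof.
move=> [Cf [N HN] bdf]; split; first exact: C1_comp_with_time.
- by exists N => p; exact: HN.
have /choice[K HK] i : exists K, forall p, `|'d f p (edx i)| <= K by exact: bdf.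
move=> h h0; exists (\sum_i (2 * `|h.2|) * K i) => p.
have [_ ->] := has_d_is_diff h (is_diff_comp_with_time (Cf.1 _) (CB.1 p)).
have -> : 'd f (with_time B p) ((h.1, 'd B p h) : E) =
    \sum_i 'd B p h 0 i *: 'd f (with_time B p) (edx i).
  by apply: etrans (d_basis _ _ _) _; rewrite /= h0 scale0r add0r.
apply: le_trans (ler_norm_sum _ _ _) _.
apply: ler_sum => i _; rewrite [X in X <= _]normrM; apply: ler_pM => //.
apply: le_trans (rV_coord_le _ _) _.
have -> : h = ((0, h.2) : E) by rewrite [LHS]surjective_pairing h0.
exact: dB.
Qed.

(** Liouville's formula: the Jacobian determinant of the flow of the field [L]
(up to the factor [al]) grows at the rate given by the divergence. The matrix
of the time derivatives of [m] is the Eulerian gradient times [m], and Jacobi's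
formula pairs it with the cofactors of [m]. *)
Lemma jacobian_liouville (L : 'I_n -> E -> R) (m : 'I_n -> 'I_n -> E -> R)
    (al : R) (p : E) : (forall i, C1 (L i)) ->
  (forall i j, differentiable (m i j) (with_time B p)) ->
  \matrix_(i, j) m i j (with_time B p) = label_jacobian (with_time B p) ->
  (forall i j, 'd (m i j) (with_time B p) edt =
     al * 'd (L i) (with_time B p) (edx j)) ->
  has_d (fun q => \det (\matrix_(i, j) m i j q)) (with_time B p) edt
   (al * (\det (label_jacobian (with_time B p)) *
    \sum_i 'd (L i \o with_time B) p (edx i))).
Proof.
move=> CL Dm mE mt; set P := with_time B p in Dm mE mt *.
set A := label_jacobian P in mE *.
have D := has_d_is_diff edt (is_diff_det (fun i j => differentiableP (Dm i j))).
apply: has_d_eq D _; rewrite mE.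
pose d i l := 'd (L i \o with_time B) p (edx l).
transitivity (\sum_i \sum_j (al * \sum_l A l j * d i l) * cofactor A i j).
  apply: eq_bigr => i _; apply: eq_bigr => j _; congr (_ * _).
  by apply: etrans (mt i j) _; congr (_ * _); exact: eulerian_gradient.
rewrite mulrA mulr_sumr; apply: eq_bigr => i _.
transitivity (\sum_l (al * d i l) * \sum_j A l j * \adj A j i).
  under [RHS]eq_bigr => l _ do rewrite mulr_sumr.
  rewrite [RHS]exchange_big/=; apply: eq_bigr => j _.
  rewrite mulr_sumr mulr_suml; apply: eq_bigr => l _.
  by rewrite !mxE; ring.
have adjE l : \sum_j A l j * \adj A j i = (\det A) *+ (l == i).
  by have := mul_mx_adj A => /matrixP/(_ l i); rewrite !mxE.
rewrite (bigD1 i)//= adjE eqxx mulr1n big1 ?addr0; last first.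
  by move=> l li; rewrite adjE (negbTE li) mulr0n mulr0.
by rewrite -/(d i i); ring.
Qed.

End Eulerian.

(** * One-sided derivatives of space-time functions *)

Section SpaceTimeBridge.
Context {R : realType} {n : nat}.
Local Notation V := 'rV[R]_n.
Local Notation E := (R * 'rV[R]_n)%type.
Implicit Types (g : E -> R) (t : R) (x : V).

Definition uncurried g : R -> V -> R := fun t x => g (t, x).

Lemma is_derive_time_slice g t x : differentiable g ((t, x) : E) ->
  is_derive t 1 ((uncurried g) ^~ x) ('d g ((t, x) : E) edt).
Proof.
move=> dg; have dl : is_diff t (fun s : R => (s, x) : E) (fun s => (s, 0) : E).
  exact: is_diff_pair (is_diff_id t) (is_diff_cst x t).
have D := is_diff_comp dl (differentiableP dg).
have [D1 D2] := D; apply: DeriveDef; first exact/derivable1_diffP.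
rewrite deriveE; last exact: D1.
exact: (congr1 (fun u => u 1) D2).
Qed.

Lemma is_derive_space_slice g t x (v : V) : differentiable g ((t, x) : E) ->
  is_derive x v (uncurried g t) ('d g ((t, x) : E) ((0, v) : E)).
Proof.
move=> dg; have dl : is_diff x (fun y : V => (t, y) : E) (fun y => (0, y) : E).
  exact: is_diff_pair (is_diff_cst t x) (is_diff_id x).
have D := is_diff_comp dl (differentiableP dg).
have [D1 D2] := D; apply: DeriveDef; first exact: diff_derivable.
rewrite deriveE; last exact: D1.
exact: (congr1 (fun u => u v) D2).
Qed.

Lemma dt_uncurried g t x : C1 g -> 0 <= t -> dt (uncurried g) t x = 'd g ((t, x) : E) edt.
Proof.
by move=> [dg _] t0; have [] := is_derive_tderive t0 (is_derive_time_slice (dg (t, x))).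
Qed.

Lemma dx_uncurried g i t x : C1 g -> dx i (uncurried g) t x = 'd g ((t, x) : E) (edx i).
Proof.
by move=> [dg _]; have [_ <-] := is_derive_space_slice (delta_mx 0 i) (dg (t, x)).
Qed.

Lemma C1_st_uncurried g : C1 g -> C1_st (uncurried g).
Proof.
move=> Cg; have [dg cg] := Cg.
have pairE (h : E -> R) : (fun p : E => h (p.1, p.2)) = h.
  by apply/funext => -[].
split.
- apply: continuous_subspaceT; rewrite /uncurried pairE.
  exact: C1_continuous.
- move=> t x t0.
  by have [] := is_derive_tderive t0 (is_derive_time_slice (dg (t, x))).
- have c1 : {within spacetime, continuous (fun p : E => 'd g p edt)}.
    exact: continuous_subspaceT.
  apply: subspace_eq_continuous c1 => -[t x]; rewrite inE /= => t0.
  by apply/esym; exact: dt_uncurried.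
- by move=> i t x _; have [] := is_derive_space_slice (delta_mx 0 i) (dg (t, x)).
- move=> i; apply: continuous_subspaceT.
  have -> : (fun p : E => dx i (uncurried g) p.1 p.2) = (fun p => 'd g p (edx i)).
    by apply/funext => -[t x]; rewrite dx_uncurried.
  exact: cg.
Qed.

End SpaceTimeBridge.

(** * The solution and its equations *)

Section EulerEquations.
Context {R : realType} {n : nat}.
Local Notation V := 'rV[R]_n.
Local Notation E := (R * 'rV[R]_n)%type.

Variables (alpha dalpha b I : R -> R) (M : R) (Q : nat -> R -> R -> R).
Hypotheses (dalphaP : forall t : R, is_derive t 1 alpha (dalpha t))
  (cdalpha : continuous dalpha)
  (alpha_bounded : exists N, forall t, `|alpha t| <= N)
  (cb : continuous b) (b01 : forall s, 0 <= b s <= 1)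
  (HQ : flow_integral b Q)
  (I0 : I 0 = 0) (dI : forall t : R, is_derive t 1 I (b t ^+ 2))
  (IM : forall t, `|I t| <= M).

Variables (w : 'I_n -> V -> R) (k : V -> R).
Hypotheses (w2 : forall i, bC2 (w i)) (k2 : bC2 k) (k0 : forall x, 0 <= k x).
Hypothesis b_alpha : forall t, 0 <= t -> b t = alpha t.

Variables (c : R) (a : R -> R).
Hypotheses (c0 : 0 < c) (wk : forall x, \sum_i w i x ^+ 2 = c ^+ 2 * k x)
  (a_gt0 : forall t, 0 <= t -> 0 < a t)
  (alphaE : forall t, 0 <= t -> alpha t = (a t)^-1)
  (dalphaE : forall t, 0 <= t -> dalpha t = - tderive a t / a t ^+ 2).

Local Notation F := (displacement Q w k).
Local Notation J := (jacobian_det Q w k).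
Local Notation L := (lag_velocity alpha w k).
Local Notation damp := (damping alpha k).

Variable B : E -> V.
Hypotheses (CB : C1 B)
  (BE : forall p, B p + F (with_time B p) = p.2)
  (BX : forall t x, B (t, x + F (t, x)) = x)
  (dB : forall p (h : V), `|'d B p ((0, h) : E)| <= 2 * `|h|)
  (J_ge : forall p, 2^-1 <= J p).

Let CF : C1 F. Proof. exact: (C1_displacement cb b01 HQ I0 dI IM w2 k2 k0). Qed.
Let bL i : bC1 spatial (L i).
Proof. exact: (bC1_lag_velocity dalphaP cdalpha alpha_bounded w2 k2 k0). Qed.
Let CL i : C1 (L i). Proof. by have [] := bL i. Qed.
Let bLe i : bC1 spatial (L i \o with_time B). Proof. exact: (bC1_eulerian CB dB). Qed.
Let CLe i : C1 (L i \o with_time B). Proof. by have [] := bLe i. Qed.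

Definition eulerian_velocity : R -> V -> V :=
  fun t x => \row_i L i (with_time B (t, x)).

Let vcompE i : vcomp eulerian_velocity i = uncurried (L i \o with_time B).
Proof. by apply/funext => t; apply/funext => x; rewrite /vcomp mxE. Qed.

Let U (q : E) : R := \sum_i L i q * L i q.

Let bU : bC1 spatial U.
Proof. by apply: bC1_sum => i; exact: bC1M. Qed.

Let CU : C1 U. Proof. by have [] := bU. Qed.
Let CUe : C1 (U \o with_time B).
Proof. by have [] := bC1_eulerian CB dB bU. Qed.

Let sqspeedE : sqspeed eulerian_velocity = uncurried (U \o with_time B).
Proof.
apply/funext => t; apply/funext => x; apply: eq_bigr => i _.
by rewrite vcompE expr2.
Qed.

Let UE q : U q = c ^+ 2 * (k q.2 * alpha q.1 ^+ 2 * damp q ^+ 2).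
Proof.
have -> : U q = (\sum_i w i q.2 ^+ 2) * (alpha q.1 * damp q) ^+ 2.
  rewrite mulr_suml; apply: eq_bigr => i _.
  by rewrite -expr2 /lag_velocity exprMn.
by rewrite wk exprMn; ring.
Qed.

Let subluminal_algebra (s K : R) : s ^+ 2 * (1 + K) = 1 ->
  c ^+ 2 - c ^+ 2 * (K * s ^+ 2) = c ^+ 2 * s ^+ 2.
Proof. by move=> sK; rewrite -{1}[c ^+ 2]mulr1 -sK; ring. Qed.

(** Relativistic identity [1 - |v|^2 / c^2 = s^2], where [s] is the damping. *)
Lemma speed_gap t x :
  c ^+ 2 - sqspeed eulerian_velocity t x = c ^+ 2 * damp (with_time B (t, x)) ^+ 2.
Proof.
rewrite sqspeedE /uncurried /= UE; apply: subluminal_algebra.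
exact: damping_sqr.
Qed.

Lemma speed_subluminal t x : sqspeed eulerian_velocity t x != c ^+ 2.
Proof.
rewrite eq_sym -subr_eq0 speed_gap gt_eqF// mulr_gt0// exprn_gt0//.
exact: damping_gt0.
Qed.

Let material (f : E -> R) t x : C1 f -> C1 (f \o with_time B) -> 0 <= t ->
  dt (uncurried (f \o with_time B)) t x +
  \sum_(j < n) vcomp eulerian_velocity j t x / a t *
     dx j (uncurried (f \o with_time B)) t x
  = 'd f (with_time B (t, x)) edt.
Proof.
move=> Cf Cfe t0; rewrite (material_derivative CF CB BE BX (t, x) Cf).
rewrite (dt_uncurried _ Cfe t0); congr (_ + _); apply: eq_bigr => j _.
rewrite (dx_uncurried _ _ _ Cfe) vcompE /uncurried; congr (_ * _).
rewrite (displacement_velocity cb b01 HQ I0 dI IM w2 k2 k0 b_alpha)//=.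
by rewrite (alphaE t0).
Qed.

Lemma momentum_holds i t x : 0 <= t -> momentum_equation c a eulerian_velocity i t x.
Proof.
move=> t0; rewrite /momentum_equation sqspeedE (vcompE i).
rewrite (material x (CL i) (CLe i) t0).
have [_ ->] := has_d_lag_velocity_dt dalphaP w2 k2 k0 i (with_time B (t, x)).
rewrite /uncurried /= UE (dalphaE t0) (alphaE t0) /lag_velocity /=.
have := damping_sqr alpha k0 (with_time B (t, x)).
rewrite /= (alphaE t0); have := a_gt0 t0.
move: (damp _) (k _) (w i _) (a t) (tderive a t) => s K W y y' y0 s1.
have -> : s ^+ 3 = s - s ^+ 3 * K * (y^-1) ^+ 2.
  by rewrite -{2}[s]mulr1 -s1; ring.
by field; rewrite !gt_eqF.
Qed.

Lemma bC1_inv_jacobian : bC1 spatial (fun q => (J q)^-1).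
Proof.
have bJ : bC1 spatial J.
  apply: bC1_det => i j.
  exact: (bC1_deformation cb b01 HQ I0 dI IM w2 k2 k0).
have pos (z : R) : 2^-1 <= z -> z != 0.
  by move=> z2; rewrite gt_eqF// (lt_le_trans _ z2)// invr_gt0.
have inv_le (z : R) : 2^-1 <= z -> `|z^-1| <= 2.
  move=> z2; have z0 : 0 < z by rewrite (lt_le_trans _ z2)// invr_gt0.
  by rewrite gtr0_norm ?invr_gt0// -[leRHS]invrK lef_pV2 ?posrE// invr_gt0.
apply: (@bC1_comp _ _ _ (fun z => z^-1) (fun z => - z ^- 2) [set z | 2^-1 <= z]) => //.
- move=> z /= /pos z0; have := @is_deriveV R id z 1 1 z0 (is_derive_id z 1).
  by rewrite [X in is_derive _ _ _ X]mulr1.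
- move=> z /= /pos z0; apply: cvgN; apply: cvgV; first by rewrite expf_neq0.
  exact: exprn_continuous.
- by exists 2 => z /= /inv_le.
- exists (2 ^+ 2) => z /= /inv_le z2.
  by rewrite normrN -exprVn normrX lerXn2r ?nnegrE.
Qed.

Variable R0 : V -> R.
Hypotheses (bR0 : bC1 setT R0) (n1 : (1 <= n)%N).

(** The density is [a^-n] times this factor, in which [1 / J] is the dilution by
the flow in comoving coordinates. *)
Definition comoving_density (q : E) : R := R0 q.2 * (damp q * (J q)^-1).
Definition lag_density (q : E) : R := alpha q.1 ^+ n * comoving_density q.
Definition eulerian_density (t : R) (x : V) : R := lag_density (with_time B (t, x)).

Lemma bC1_comoving_density : bC1 spatial comoving_density.
Proof.
have bd := bC1_damping dalphaP cdalpha alpha_bounded k2 k0.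
exact: bC1M (bC1_space bR0) (bC1M bd bC1_inv_jacobian).
Qed.

Lemma bC1_time_power : bC1 spatial (fun q : E => alpha q.1 ^+ n).
Proof. exact: bC1X (bC1_time dalphaP cdalpha alpha_bounded). Qed.

Lemma has_d_time_power (p h : E) : has_d (fun q : E => alpha q.1 ^+ n) p h
  (h.1 * (n%:R * alpha p.1 ^+ n.-1 * dalpha p.1)).
Proof.
have D : is_derive (p.1) 1 (fun t => alpha t ^+ n)
    ((fun t => n%:R * alpha t ^+ n.-1 * dalpha t) (p.1)).
  rewrite (_ : (fun t => _) = alpha ^+ n); last by apply/funext => t; rewrite fctE.
  exact: is_deriveX (dalphaP (p.1)).
exact: has_d_is_diff h (@is_diff_time R n (fun t => alpha t ^+ n)
  (fun t => n%:R * alpha t ^+ n.-1 * dalpha t) p D).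
Qed.

Let bN : bC1 spatial lag_density.
Proof. exact: bC1M bC1_time_power bC1_comoving_density. Qed.
Let CN : C1 lag_density. Proof. by have [] := bN. Qed.

Lemma bC1_eulerian_density : bC1 spatial (lag_density \o with_time B).
Proof. exact: (bC1_eulerian CB dB bN). Qed.

Let CNe : C1 (lag_density \o with_time B).
Proof. by have [] := bC1_eulerian_density. Qed.

Let densE : eulerian_density = uncurried (lag_density \o with_time B).
Proof. by []. Qed.

Let jacobianE q : \matrix_(i, j) deformation Q w k i j q = label_jacobian F q.
Proof.
apply/matrixP => i j; rewrite !mxE.
by rewrite (d_displacement_dx cb b01 HQ I0 dI IM w2 k2 k0).
Qed.

Let divergence (p : E) : R := \sum_i 'd (L i \o with_time B) p (edx i).

Lemma has_d_jacobian (p : E) : 0 <= p.1 ->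
  has_d J (with_time B p) edt (alpha p.1 * (J (with_time B p) * divergence p)).
Proof.
move=> p0; rewrite {2}/jacobian_det jacobianE.
apply: (jacobian_liouville CF CB BE BX CL) => [i j||i j].
- have [[D _] _ _] := bC1_deformation cb b01 HQ I0 dI IM w2 k2 k0 i j.
  exact: D.
- exact: jacobianE.
- exact: (deformation_velocity dalphaP b01 HQ I0 dI IM w2 k2 k0 b_alpha).
Qed.

Let log_derivative_algebra (s j K r X y z u v N : R) : j != 0 ->
  X * (r * (s * (- j ^- 2 * (y * (j * v))) + j^-1 * (- s ^+ 3 * K * y * u)))
    + (r * (s * j^-1)) * (N * (X * z) * u) =
  X * (r * (s * j^-1)) * (N * z * u - s ^+ 2 * K * y * u - y * v).
Proof. by move=> j0; field. Qed.

(** The continuity equation along a characteristic, in logarithmic form: the three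
terms come from [a^-n], from the damping and from the Jacobian. *)
Lemma has_d_lag_density (p : E) : 0 <= p.1 ->
  has_d lag_density (with_time B p) edt (lag_density (with_time B p) *
    (n%:R * a p.1 * dalpha p.1
     - damp (with_time B p) ^+ 2 * k (B p) * alpha p.1 * dalpha p.1
     - alpha p.1 * divergence p)).
Proof.
move=> p0; set P := with_time B p.
have J0 : J P != 0 by rewrite gt_eqF// (lt_le_trans _ (J_ge P))// invr_gt0.
have hJ := has_d_jacobian p0; rewrite -/P in hJ.
have dinv : is_derive (J P) 1 (fun z => z^-1) (- (J P) ^- 2).
  have := @is_deriveV R id (J P) 1 1 J0 (is_derive_id (J P) 1).
  by rewrite [X in is_derive _ _ _ X]mulr1.
have hJi := has_d_comp1 dinv hJ.
have hs := has_d_damping_dt dalphaP k2 k0 P.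
have [[DR _] _ _] := bR0.
have hR := has_d_is_diff edt (is_diff_space (DR (P.2))).
have hal : has_d (fun q : E => alpha q.1 ^+ n) P edt
    (n%:R * alpha p.1 ^+ n.-1 * dalpha p.1).
  by apply: has_d_eq (has_d_time_power P edt) _; rewrite mul1r.
have D := has_dM hal (has_dM hR (has_dM hs hJi)).
apply: (has_d_eq D); rewrite linear0 mulr0 addr0.
rewrite /lag_density /comoving_density -/P.
rewrite -[(P).2]/(B p) -[(P).1]/(p.1).
have al0 : alpha p.1 * a p.1 = 1.
  by rewrite alphaE// mulVf// gt_eqF// a_gt0.
have alX : alpha p.1 ^+ n.-1 = alpha p.1 ^+ n * a p.1.
  have -> : alpha p.1 ^+ n = alpha p.1 * alpha p.1 ^+ n.-1.
    by rewrite -exprS prednK.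
  by rewrite mulrAC al0 mul1r.
rewrite alX.
exact: log_derivative_algebra.
Qed.

Let dtU (p : E) : 'd U (with_time B p) edt =
  2 * c ^+ 2 * k (B p) * alpha p.1 * dalpha p.1 * damp (with_time B p) ^+ 4.
Proof.
set P := with_time B p.
have hL i := has_d_lag_velocity_dt dalphaP w2 k2 k0 i P.
have [_ D] := has_d_sum (index_enum 'I_n) (fun i => has_dM (hL i) (hL i)).
apply: etrans D _.
transitivity (\sum_i (2 * alpha p.1 * dalpha p.1 * damp P ^+ 4) * w i (B p) ^+ 2).
  apply: eq_bigr => i _; rewrite /lag_velocity -[P.2]/(B p) -[P.1]/(p.1).
  by move: (w i _) (alpha _) (damp P) (dalpha _) => x y z u; ring.
by rewrite -mulr_sumr wk; ring.
Qed.

Let continuity_algebra (N r s K y y' D T : R) : c != 0 -> s != 0 -> y != 0 ->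
  r * (N * y * (- y' / y ^+ 2) - s ^+ 2 * K * y^-1 * (- y' / y ^+ 2) - y^-1 * D)
  + r * (y' / y * (c ^+ 2 * (K * y^-1 ^+ 2 * s ^+ 2) / c ^+ 2 + N)
    + (2 * c ^+ 2 * K * y^-1 * (- y' / y ^+ 2) * s ^+ 4 - T) / (c ^+ 2 * s ^+ 2)
    + (y^-1 * D + T / (c ^+ 2 * s ^+ 2))) = 0.
Proof. by move=> cn0 s0 y0; field; rewrite cn0 s0 y0. Qed.

(** Grouped together, the terms in the derivatives of [u = |v|^2] form the material
derivative of [u] divided by [c^2 - u], which is known from the momentum
equation; the rest is [has_d_lag_density]. *)
Lemma continuity_holds t x : 0 <= t ->
  continuity_equation c a eulerian_density eulerian_velocity t x.
Proof.
move=> t0; rewrite /continuity_equation densE.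
rewrite (material x CN CNe t0).
have [_ ->] := has_d_lag_density (p := (t, x)) t0.
rewrite big_split/= speed_gap.
set P := with_time B (t, x); set r := lag_density P.
have a0 : a t != 0 by rewrite gt_eqF// a_gt0.
have s0 : damp P != 0 by rewrite gt_eqF// damping_gt0.
have cn0 : c != 0 by rewrite gt_eqF.
set d := c ^+ 2 * damp P ^+ 2.
have d0 : d != 0 by rewrite mulf_neq0 ?expf_neq0.
pose T := \sum_(j < n) vcomp eulerian_velocity j t x / a t
  * dx j (sqspeed eulerian_velocity) t x.
have S1 : \sum_(i < n) dx i (vcomp eulerian_velocity i) t x * (1 / a t) =
    (a t)^-1 * divergence (t, x).
  rewrite mulr_sumr; apply: eq_bigr => i _.
  by rewrite vcompE (dx_uncurried _ _ _ (CLe i)) mul1r mulrC.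
have S2 : \sum_(i < n) dx i (sqspeed eulerian_velocity) t x *
    (vcomp eulerian_velocity i t x / (a t * d)) = T / d.
  rewrite mulr_suml; apply: eq_bigr => i _.
  move: (dx _ _ _ _) (vcomp _ _ _ _) => X Y.
  by field; rewrite a0 d0.
have S3 : dt (sqspeed eulerian_velocity) t x =
    2 * c ^+ 2 * k (B (t, x)) * alpha t * dalpha t * damp P ^+ 4 - T.
  have := material x CU CUe t0; rewrite -sqspeedE (dtU (t, x)) => <-.
  by rewrite addrK.
rewrite S1 S2 S3 sqspeedE /uncurried /= -/P UE.
rewrite -[P.2]/(B (t, x)) -[P.1]/t (alphaE t0) (dalphaE t0).
exact: continuity_algebra.
Qed.

Lemma C1_st_eulerian_velocity i : C1_st (vcomp eulerian_velocity i).
Proof. by rewrite vcompE; exact: (C1_st_uncurried (CLe i)). Qed.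

Lemma C1_st_eulerian_density : C1_st eulerian_density.
Proof. exact: (C1_st_uncurried CNe). Qed.

(** Except for [a^-n], the density is a bounded function with bounded gradient, and
[a^-n] does not depend on the space variable. *)
Lemma eulerian_density_estimate : exists C : R, 0 < C /\ forall t x,
  `|eulerian_density t x| <= `|alpha t ^+ n| * C /\
  forall i, `|dx i eulerian_density t x| <= `|alpha t ^+ n| * C.
Proof.
have bG := bC1_eulerian CB dB bC1_comoving_density.
have [[DG _] [N HN] bdG] := bG.
have /choice[K HK] i : exists K, forall p,
    `|'d (comoving_density \o with_time B) p (edx i)| <= K by exact: bdG.
exists (1 + (`|N| + \sum_i `|K i|)).
have s0 : 0 <= \sum_i `|K i| by rewrite sumr_ge0.
have N0 : 0 <= `|N| by [].
split; first by rewrite ltr_pwDl// addr_ge0.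
move=> t x; split=> [|i].
  have -> : eulerian_density t x =
      alpha t ^+ n * (comoving_density \o with_time B) (t, x) by [].
  rewrite normrM ler_wpM2l//; apply: le_trans (HN _) _.
  by apply: le_trans (ler_norm _) _; lra.
rewrite densE (dx_uncurried _ _ _ CNe).
have hal : has_d (fun q : E => alpha q.1 ^+ n) ((t, x) : E) (edx i) 0.
  by apply: has_d_eq (has_d_time_power (t, x) (edx i)) _; rewrite mul0r.
have hG : has_d (comoving_density \o with_time B) ((t, x) : E) (edx i)
  ('d (comoving_density \o with_time B) ((t, x) : E) (edx i)) by split.
have [_ D] := has_dM hal hG.
have -> : 'd (lag_density \o with_time B) ((t, x) : E) (edx i) =
    alpha t ^+ n * 'd (comoving_density \o with_time B) ((t, x) : E) (edx i).
  by apply: etrans D _; rewrite mulr0 addr0.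
rewrite normrM ler_wpM2l//; apply: le_trans (HK _ _) _.
apply: le_trans (ler_norm _) _.
have : `|K i| <= \sum_i `|K i| by rewrite (bigD1 i)//= lerDl sumr_ge0.
by move=> h; lra.
Qed.

Lemma eulerian_density_bounded :
  bounded_st eulerian_density /\ forall i, bounded_st (dx i eulerian_density).
Proof.
have [C [C0 HC]] := eulerian_density_estimate; have [N HN] := alpha_bounded.
have aN t : `|alpha t ^+ n| * C <= N ^+ n * C.
  rewrite ler_wpM2r ?(ltW C0)// normrX lerXn2r ?nnegrE ?HN//.
  exact: le_trans (normr_ge0 _) (HN 0).
split=> [|i]; exists (N ^+ n * C) => t x _; have [H1 H2] := HC t x.
  exact: le_trans H1 (aN t).
exact: le_trans (H2 i) (aN t).
Qed.

Lemma eulerian_density_decays :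
  (forall K, 0 < K -> exists T, 0 <= T /\ forall t, T <= t -> K <= a t) ->
  decays_to_zero eulerian_density /\ forall i, decays_to_zero (dx i eulerian_density).
Proof.
move=> ainf; have [C [C0 HC]] := eulerian_density_estimate.
have small e : 0 < e -> \forall t \near +oo, `|alpha t ^+ n| * C <= e.
  move=> e0; have K0 : 0 < Num.max 1 (C / e) by rewrite lt_max ltr01.
  have [T [T0 HT]] := ainf _ K0.
  exists T; split; first exact: num_real.
  move=> t /ltW Tt; have t0 : 0 <= t := le_trans T0 Tt.
  have := HT t Tt; rewrite ge_max => /andP[a1 aC].
  have a0 := a_gt0 t0; rewrite (alphaE t0).
  have y0 : 0 <= (a t)^-1 by rewrite invr_ge0 ltW.
  have y1 : (a t)^-1 <= 1 by rewrite invf_le1.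
  rewrite ger0_norm ?exprn_ge0//.
  apply: (@le_trans _ _ ((a t)^-1 * C)).
    rewrite ler_wpM2r ?(ltW C0)// -(prednK n1) exprS ler_piMr//.
    by rewrite exprn_ile1.
  by rewrite ler_pdivrMl// -ler_pdivrMr.
split=> [|i] e e0; have := small e e0; apply: filterS => t Ht x;
  have [H1 H2] := HC t x.
- exact: le_trans H1 Ht.
- exact: le_trans (H2 i) Ht.
Qed.

End EulerEquations.

(** * Small data and conclusion *)

Section SmallDisplacement.
Context {R : realType} {n : nat}.
Local Notation V := 'rV[R]_n.
Local Notation E := (R * 'rV[R]_n)%type.

Variables (b I : R -> R) (M W : R) (Q : nat -> R -> R -> R).
Hypotheses (cb : continuous b) (b01 : forall s, 0 <= b s <= 1)
  (HQ : flow_integral b Q)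
  (I0 : I 0 = 0) (dI : forall t : R, is_derive t 1 I (b t ^+ 2))
  (IM : forall t, `|I t| <= M).

Variables (w : 'I_n -> V -> R) (k : V -> R).
Hypotheses (w2 : forall i, bC2 (w i)) (k2 : bC2 k) (k0 : forall x, 0 <= k x)
  (wW : forall i x, `|w i x| <= W)
  (dwW : forall i j x, `|'d (w i) x (delta_mx 0 j)| <= W)
  (dk1 : forall j x, `|'d k x (delta_mx 0 j)| <= 1).

(** The momentum and its gradient are at most [W] and the time integrals at most
[M], so the gradient of the displacement is small uniformly in time. *)
Lemma displacement_dx_le i j p : `|displacement_dx Q w k i j p| <= 2 * W * M.
Proof.
have W0 : 0 <= W := le_trans (normr_ge0 _) (wW i 0).
have M0 : 0 <= M := le_trans (normr_ge0 _) (IM 0).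
have h0 : `|flow_along Q k 0 p| <= M.
  apply: le_trans (flow_integral_bound b01 HQ I0 dI IM 0 _ (k0 _)) _.
  by rewrite normr1 mul1r.
have h1 : `|flow_along Q k 1 p| <= M.
  apply: le_trans (flow_integral_bound b01 HQ I0 dI IM 1 _ (k0 _)) _.
  by rewrite ler_piMl//= mulr1 normrN ger0_norm//; lra.
have -> : 2 * W * M = W * M + W * (M * 1) by ring.
apply: le_trans (ler_normD _ _) _; rewrite !normrM; apply: lerD.
  by apply: ler_pM => //; exact: dwW.
apply: ler_pM => //; apply: ler_pM => //; exact: dk1.
Qed.

Lemma displacement_contraction : 2 * W * M * n%:R <= 2^-1 ->
  forall p (h : V), `|'d (displacement Q w k) p ((0, h) : E)| <= 2^-1 * `|h|.
Proof.
move=> WM p h; apply: rV_norm_le => [|i]; first by rewrite mulr_ge0.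
rewrite d_basis /= scale0r add0r summxE.
apply: le_trans (ler_norm_sum _ _ _) _.
apply: (@le_trans _ _ (\sum_(j < n) `|h| * (2 * W * M))).
  apply: ler_sum => j _; rewrite mxE normrM; apply: ler_pM => //.
    exact: rV_coord_le.
  rewrite (d_displacement_dx cb b01 HQ I0 dI IM w2 k2 k0).
  exact: displacement_dx_le.
rewrite sumr_const card_ord -mulrnAr -mulr_natr mulrC ler_wpM2r//.
Qed.

Lemma jacobian_det_ge (eta : R) :
  (forall A : 'M[R]_n, (forall i j, `|A i j - (i == j)%:R| <= eta) -> 2^-1 <= \det A) ->
  2 * W * M <= eta -> forall p, 2^-1 <= jacobian_det Q w k p.
Proof.
move=> Heta WM p; apply: Heta => i j; rewrite mxE /deformation addrAC subrr add0r.
exact: le_trans (displacement_dx_le _ _ _) WM.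
Qed.

End SmallDisplacement.

Lemma flow_integral_exists {R : realType} (b : R -> R) : continuous b ->
  (forall s, 0 <= b s <= 1) -> (forall s, s <= -1 -> b s = 0) ->
  exists Q, flow_integral b Q.
Proof.
move=> cb b01 b0.
have H (jk : nat * R) : exists F : R -> R, 0 <= jk.2 ->
    F 0 = 0 /\ forall t : R, is_derive t 1 F (flow_rate b jk.1 jk.2 t).
  have [k0|k0] := leP 0 jk.2; last first.
    by exists (cst 0).
  have z s : s <= -1 -> flow_rate b jk.1 jk.2 s = 0.
    by move=> s1; rewrite /flow_rate b0// expr0n addn2 mul0r.
  have [F F0 dF] := primitive_exists (continuous_flow_rate cb b01 (j := jk.1) k0) z.
  by exists F.
have [G HG] := choice H.
by exists (fun j k => G (j, k)) => j k k0; exact: (HG (j, k)).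
Qed.

Unset Implicit Arguments.

Theorem theorem1p3 (R : realType) (n : nat) (c : R) (a : R -> R)
    (rho0 : 'rV[R]_n -> R) (v0 : 'rV[R]_n -> 'rV[R]_n)
    (hn : (1 <= n)%N) (hc : 0 < c)
    (hrho0 : Ck 1 rho0) (hrho0_bounded : bounded_Ck_norm 1 rho0)
    (hv0 : forall i : 'I_n, Ck 2 (fun x => v0 x 0 i))
    (hv0_bounded : forall i : 'I_n, bounded_Ck_norm 2 (fun x => v0 x 0 i))
    (ha : scale_factor a) (hH : assumption_H1 a \/ assumption_H2 a) :
  exists eps0 : R, 0 < eps0 /\
    forall eps : R, 0 <= eps <= eps0 ->
      exists (rho : R -> 'rV[R]_n -> R) (v : R -> 'rV[R]_n -> 'rV[R]_n),
        [/\ global_classical_solution c a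
              (fun x => eps * rho0 x) (fun x => eps *: v0 x) rho v,
            bounded_st rho /\ (forall i : 'I_n, bounded_st (dx i rho))
          & decays_to_zero rho /\ (forall i : 'I_n, decays_to_zero (dx i rho))].
Proof.
have [da_gt0 [m [delta [m0 delta0 growth]]]] := scale_factor_growth ha hH.
have a_gt0 t : 0 <= t -> 0 < a t by case: ha => _ H _ _; exact: H.
have a0 : a 0 = 1 by case: ha.
pose alpha := inv_scale a; pose dalpha := inv_scale_deriv a.
have dalphaP := is_derive_inv_scale ha.
have cdalpha := continuous_inv_scale_deriv ha.
have alpha_bounded := inv_scale_bounded ha da_gt0.
have alphaE t : 0 <= t -> alpha t = (a t)^-1.
  by move=> t0; rewrite /alpha /inv_scale /glue0 t0.
have dalphaE t : 0 <= t -> dalpha t = - tderive a t / a t ^+ 2.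
  by move=> t0; rewrite /dalpha /inv_scale_deriv /glue0 t0.
pose b := cut_inv_scale a.
have cb := continuous_cut_inv_scale ha.
have b01 := cut_inv_scale_01 ha da_gt0.
have b_alpha t : 0 <= t -> b t = alpha t.
  by move=> t0; rewrite alphaE// /b /cut_inv_scale /glue0 t0.
have [I [I0 dI [M0 IM0]]] := cut_inv_scale_sqr_primitive ha da_gt0 m0 delta0 growth.
pose M := 1 + `|M0|.
have M_gt0 : 0 < M by rewrite ltr_pwDl.
have IM t : `|I t| <= M.
  apply: le_trans (IM0 t) _; apply: le_trans (ler_norm _) _.
  by rewrite lerDr.
have [Q HQ] := flow_integral_exists cb b01 (@cut_inv_scale_early _ a).
have [eta eta0 Heta] := @det_near_identity R n.
pose f (i : 'I_n) := fun x => v0 x 0 i.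
have f2 i : bC2 (f i) := Ck2_bC2 (hv0 i) (hv0_bounded i).
have n0 : 0 < n%:R :> R by rewrite ltr0n.
(* The bound [eta] keeps the Jacobian at least 1/2, the other one makes the
   displacement 1/2-contracting for the maximum norm. *)
pose mu := Num.min eta (2 * n%:R)^-1.
have mu0 : 0 < mu by rewrite lt_min eta0 invr_gt0 mulr_gt0.
pose W := mu / (2 * M).
have W0 : 0 < W by rewrite divr_gt0// mulr_gt0.
have WM : 2 * W * M = mu by rewrite /W; field; rewrite gt_eqF.
have [eps0 [eps0_gt0 Heps]] := small_momentum hc hn W0 f2.
exists eps0; split=> // eps /Heps[g2 s_le wW dwW dk1].
set g := (fun i x => eps * f i x) in g2 s_le wW dwW dk1.
pose w := momentum c g; pose k := momentum2 c g.
have w2 : forall i, bC2 (w i) := bC2_momentum g2 s_le.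
have k2 : bC2 k := bC2_momentum2 g2 s_le.
have k0 : forall x, 0 <= k x := momentum2_ge0 s_le.
have wk : forall x, \sum_i w i x ^+ 2 = c ^+ 2 * k x := sum_momentum_sqr hc s_le.
have WMn : 2 * W * M * n%:R <= 2^-1.
  have mun : mu <= (2 * n%:R)^-1 by rewrite ge_min lexx orbT.
  rewrite WM; apply: le_trans (ler_wpM2r (ltW n0) mun) _.
  by rewrite invfM mulfVK// gt_eqF.
have CF := C1_displacement cb b01 HQ I0 dI IM w2 k2 k0.
have HF := displacement_contraction cb b01 HQ I0 dI IM w2 k2 k0 wW dwW dk1 WMn.
have WMeta : 2 * W * M <= eta by rewrite WM ge_min lexx.
have J_ge := jacobian_det_ge b01 HQ I0 dI IM k0 wW dwW dk1 Heta WMeta.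
have [B [CB BE BX dB]] := perturbed_identity_inverse CF HF.
pose R0 x := eps * rho0 x * lorentz c g x.
have bR0 : bC1 setT R0.
  have br := Ck1_bC1 hrho0 hrho0_bounded.
  have [bl _] := bC2_lorentz g2 s_le.
  exact: bC1M (bC1M (bC1_cst _ eps) br) bl.
exists (eulerian_density alpha Q w k B R0), (eulerian_velocity alpha w k B).
split; first split.
- split.
    exact: (C1_st_eulerian_density dalphaP cdalpha alpha_bounded cb b01 HQ I0 dI
      IM w2 k2 k0 CB dB J_ge bR0).
  move=> i.
  exact: (C1_st_eulerian_velocity dalphaP cdalpha alpha_bounded w2 k2 k0 CB dB).
- by move=> t x _; exact: speed_subluminal.
- move=> t x t0.
  exact: (continuity_holds dalphaP cdalpha alpha_bounded cb b01 HQ I0 dI IM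
    w2 k2 k0 b_alpha hc wk a_gt0 alphaE dalphaE CB BE BX dB J_ge bR0 hn).
- move=> t x t0 i.
  exact: (momentum_holds dalphaP cdalpha alpha_bounded cb b01 HQ I0 dI IM
    w2 k2 k0 b_alpha hc wk a_gt0 alphaE dalphaE CB BE BX dB).
- move=> x.
  have B0 : B (0, x) = x.
    by have := BX 0 x; rewrite (displacement0 HQ w k0) addr0.
  have alpha0 : alpha 0 = 1 by rewrite alphaE// a0 invr1.
  have dampE : lorentz c g x * damping alpha k (0, x) = 1.
    rewrite /damping /= alpha0 expr1n mulr1 /isqrt1_iter /= mul1r expr1.
    exact: isqrt1_momentum2.
  split.
    rewrite /eulerian_density /lag_density /comoving_density /with_time /= B0.
    rewrite alpha0 expr1n mul1r (jacobian_det0 HQ w k0) invr1 mulr1 /R0.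
    by rewrite -mulrA dampE mulr1.
  apply/rowP => i; rewrite !mxE /lag_velocity /with_time /= B0 alpha0 mul1r.
  by rewrite /w /momentum -mulrA dampE mulr1.
- exact: (eulerian_density_bounded dalphaP cdalpha alpha_bounded cb b01 HQ I0 dI
    IM w2 k2 k0 CB dB J_ge bR0).
- apply: (eulerian_density_decays dalphaP cdalpha alpha_bounded cb b01 HQ I0 dI
    IM w2 k2 k0 a_gt0 alphaE CB dB J_ge bR0 hn).
  by move=> K; exact: scale_factor_unbounded growth K.
Qed.
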